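(* Let $R$ be an affine domain of characteristic zero with finite quotients, let $n$ be a positive integer, and let $f \in R[x_1,\dots,x_n]^n$. Then the polynomial map $f \colon R^n \to R^n$ is surjective if and only if the polynomial map $f \colon \widehat{R_{\mathfrak{m}}}^n \to \widehat{R_{\mathfrak{m}}}^n$ is surjective for every maximal ideal $\mathfrak{m} \subseteq R$.
   Context: All rings are commutative with unity. A domain $R$ is called affine if it is either finitely generated as a ring (i.e. as a $\mathbb{Z}$-algebra) or finitely generated as an algebra over a subfield. An affine domain $R$ has finite quotients if $R/\mathfrak{m}$ is finite for every maximal ideal $\mathfrak{m} \subseteq R$. For $f = (f_1,\dots,f_n) \in R[x_1,\dots,x_n]^n$ and an $R$-algebra $S$, the polynomial map $f \colon S^n \to S^n$ is $a \mapsto (f_1(a),\dots,f_n(a))$. For a maximal ideal $\mathfrak{m} \subseteq R$, $R_{\mathfrak{m}}$ is the localization of $R$ at $\mathfrak{m}$ and $\widehat{R_{\mathfrak{m}}}$ denotes the completion of $R$ with respect to $\mathfrak{m}$ (equivalently, the completion of the local ring $R_{\mathfrak{m}}$ with respect to its maximal ideal). *)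

(* Defs.v *)
From HB Require Import structures.
From mathcomp Require Import all_boot all_order all_algebra.
From mathcomp Require Import boolp classical_sets cardinality.
From mathcomp Require Import mpoly.

Set Implicit Arguments.
Unset Strict Implicit.
Unset Printing Implicit Defensive.

Import GRing.Theory.

Local Open Scope ring_scope.
Local Open Scope quotient_scope.

(* MathComp's [idealr R] is the type of proper ideals of R, given as boolean
   predicates; by [boolp] every subset of R is of this form. *)
Definition maximal_ideal (R : comNzRingType) (m : idealr R) : Prop :=
  forall J : idealr R, {subset m <= J} -> {subset J <= m}.

Section IdealPower.
Variable R : comNzRingType.

Definition ideal_mul (I J : {pred R}) : {pred R} := fun x =>
  `[< exists2 s : seq (R * R),
        all [pred u | (u.1 \in I) && (u.2 \in J)] s
      & x = \sum_(u <- s) u.1 * u.2 >].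

Definition ideal_pow (I : {pred R}) (k : nat) : {pred R} :=
  iter k (ideal_mul I) predT.

Lemma ideal_powSP (I : {pred R}) k x :
  reflect (exists2 s : seq (R * R),
             all [pred u | (u.1 \in I) && (u.2 \in ideal_pow I k)] s
           & x = \sum_(u <- s) u.1 * u.2)
          (x \in ideal_pow I k.+1).
Proof. exact: asboolP. Qed.

Lemma ideal_powS_sub (I : idealr R) k : {subset ideal_pow I k.+1 <= I}.
Proof.
move=> x /ideal_powSP[s /allP s_in ->]; rewrite big_seq.
by apply: rpred_sum => u /s_in /andP[uI _]; rewrite mulrC idealMr.
Qed.

Lemma ideal_powS_decr (I : idealr R) k :
  {subset ideal_pow I k.+1 <= ideal_pow I k}.
Proof.
elim: k => [//|k IHk] x /ideal_powSP[s s_in ->].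
apply/ideal_powSP; exists s => //; apply: sub_all s_in => u /=.
by case/andP=> -> /IHk.
Qed.

Variables (I : idealr R) (k : nat).

Definition ideal_powS : R -> bool := ideal_pow I k.+1.

Lemma ideal_powS_idealr_closed : idealr_closed ideal_powS.
Proof.
split; first by apply/ideal_powSP; exists [::]; rewrite ?big_nil.
  by apply: contraFN (idealr1 I) => /ideal_powS_sub.
move=> a x y /ideal_powSP[s s_in ->] /ideal_powSP[t t_in ->].
apply/ideal_powSP; exists ([seq (a * u.1, u.2) | u <- s] ++ t).
  rewrite all_cat t_in andbT all_map; apply: sub_all s_in => u /=.
  by case/andP=> uI ->; rewrite idealMr.
rewrite big_cat big_map /= mulr_sumr; congr (_ + _).
by apply: eq_bigr => u _; rewrite mulrA.
Qed.

HB.instance Definition _ := isIdealr.Build R ideal_powS ideal_powS_idealr_closed.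

End IdealPower.

Section Completion.
Variables (R : comNzRingType) (I : idealr R).

Definition quot_pow (k : nat) : comNzRingType :=
  {ideal_quot (ideal_powS I k : idealr R)}.

Definition proj_pow (k : nat) : {rmorphism R -> quot_pow k} :=
  \pi_({ideal_quot (ideal_powS I k : idealr R)}).

Lemma proj_pow_eq k x y :
  (proj_pow k x == proj_pow k y) = (x - y \in ideal_pow I k.+1).
Proof. by rewrite (Quotient.idealrBE (ideal_powS I k : idealr R)). Qed.

Definition transition (k : nat) (q : quot_pow k.+1) : quot_pow k :=
  proj_pow k (repr q).

Lemma transition_proj k x : transition (proj_pow k.+1 x) = proj_pow k x.
Proof.
apply/eqP; rewrite proj_pow_eq; apply: ideal_powS_decr.
by rewrite -proj_pow_eq /= reprK.
Qed.

Lemma proj_pow_surj k (q : quot_pow k) : {x : R | proj_pow k x = q}.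
Proof. by exists (repr q); rewrite /= reprK. Qed.

Lemma transition_is_zmod_morphism k : zmod_morphism (@transition k).
Proof.
move=> p q; case: (proj_pow_surj p) (proj_pow_surj q) => [x <-] [y <-].
by rewrite -rmorphB !transition_proj rmorphB.
Qed.

Lemma transition_is_monoid_morphism k : monoid_morphism (@transition k).
Proof.
split=> [|p q]; first by rewrite -(rmorph1 (proj_pow k.+1)) transition_proj rmorph1.
case: (proj_pow_surj p) (proj_pow_surj q) => [x <-] [y <-].
by rewrite -rmorphM !transition_proj rmorphM.
Qed.

HB.instance Definition _ k :=
  GRing.isZmodMorphism.Build (quot_pow k.+1) (quot_pow k) (@transition k)
    (@transition_is_zmod_morphism k).
HB.instance Definition _ k :=
  GRing.isMonoidMorphism.Build (quot_pow k.+1) (quot_pow k) (@transition k)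
    (@transition_is_monoid_morphism k).

(* The completion is lim_k R/I^k; starting the inverse system at k = 1 drops
   only the zero ring R/I^0, so that all its terms are comNzRingTypes. *)
Record completion := Completion {
  comp_seq :> forall k, quot_pow k;
  comp_compat : forall k, transition (comp_seq k.+1) = comp_seq k
}.

Lemma completionP (x y : completion) : (forall k, x k = y k) -> x = y.
Proof.
case: x y => [x xP] [y yP] /= xy.
have {}xy : x = y by exact: functional_extensionality_dep.
by subst y; congr Completion; exact: Prop_irrelevance.
Qed.

HB.instance Definition _ := gen_eqMixin completion.
HB.instance Definition _ := gen_choiceMixin completion.

Definition comp_of (x : R) : completion :=
  @Completion (fun k => proj_pow k x) (fun k => transition_proj k x).

Fact comp_opp_compat (x : completion) k : transition (- x k.+1) = - x k.
Proof. by rewrite rmorphN /= comp_compat. Qed.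
Fact comp_add_compat (x y : completion) k :
  transition (x k.+1 + y k.+1) = x k + y k.
Proof. by rewrite rmorphD /= !comp_compat. Qed.
Fact comp_mul_compat (x y : completion) k :
  transition (x k.+1 * y k.+1) = x k * y k.
Proof. by rewrite rmorphM /= !comp_compat. Qed.

Definition comp_opp (x : completion) :=
  @Completion (fun k => - x k) (comp_opp_compat x).
Definition comp_add (x y : completion) :=
  @Completion (fun k => x k + y k) (comp_add_compat x y).
Definition comp_mul (x y : completion) :=
  @Completion (fun k => x k * y k) (comp_mul_compat x y).

Fact comp_addA : associative comp_add.
Proof. by move=> x y z; apply: completionP => k; exact: addrA. Qed.
Fact comp_addC : commutative comp_add.
Proof. by move=> x y; apply: completionP => k; exact: addrC. Qed.
Fact comp_add0 : left_id (comp_of 0) comp_add.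
Proof. by move=> x; apply: completionP => k; rewrite /= rmorph0 add0r. Qed.
Fact comp_addN : left_inverse (comp_of 0) comp_opp comp_add.
Proof. by move=> x; apply: completionP => k; rewrite /= rmorph0 addNr. Qed.

HB.instance Definition _ :=
  GRing.isZmodule.Build completion comp_addA comp_addC comp_add0 comp_addN.

Fact comp_mulA : associative comp_mul.
Proof. by move=> x y z; apply: completionP => k; exact: mulrA. Qed.
Fact comp_mulC : commutative comp_mul.
Proof. by move=> x y; apply: completionP => k; exact: mulrC. Qed.
Fact comp_mul1 : left_id (comp_of 1) comp_mul.
Proof. by move=> x; apply: completionP => k; rewrite /= rmorph1 mul1r. Qed.
Fact comp_mulDl : left_distributive comp_mul comp_add.
Proof. by move=> x y z; apply: completionP => k; exact: mulrDl. Qed.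
Fact comp_one_neq0 : comp_of 1 != comp_of 0.
Proof.
apply/eqP => /(congr1 (fun x : completion => x 0%N)) /= /eqP.
by rewrite rmorph1 rmorph0 oner_eq0.
Qed.

HB.instance Definition _ := GRing.Zmodule_isComNzRing.Build completion
  comp_mulA comp_mulC comp_mul1 comp_mulDl comp_one_neq0.

Fact comp_of_is_zmod_morphism : zmod_morphism comp_of.
Proof. by move=> x y; apply: completionP => k; exact: rmorphB. Qed.
Fact comp_of_is_monoid_morphism : monoid_morphism comp_of.
Proof. by split=> // x y; apply: completionP => k; exact: rmorphM. Qed.

HB.instance Definition _ :=
  GRing.isZmodMorphism.Build R completion comp_of comp_of_is_zmod_morphism.
HB.instance Definition _ :=
  GRing.isMonoidMorphism.Build R completion comp_of comp_of_is_monoid_morphism.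

End Completion.

Definition subfield (R : comNzRingType) (K : {pred R}) : Prop :=
  subring_closed K /\
  {in K, forall x, x != 0 -> exists2 y, y \in K & x * y = 1}.

Definition fin_gen_ring (R : comNzRingType) : Prop :=
  exists (k : nat) (a : 'I_k -> R),
    forall x, exists p : {mpoly int[k]}, x = mmap intr a p.

Definition fin_gen_over (R : comNzRingType) (K : {pred R}) : Prop :=
  exists (k : nat) (a : 'I_k -> R),
    forall x, exists2 p : {mpoly R[k]}, p \is a mpolyOver k K & x = p.@[a].

Definition affine (R : comNzRingType) : Prop :=
  fin_gen_ring R \/ exists2 K : {pred R}, subfield K & fin_gen_over K.

Definition finite_quotients (R : comNzRingType) : Prop :=
  forall m : idealr R, maximal_ideal m -> finite_set [set: {ideal_quot m}].

(* The R-algebra structure of S is carried by its structure morphism phi. *)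
Definition poly_map (R S : comNzRingType) (phi : {rmorphism R -> S}) (n : nat)
    (f : 'I_n -> {mpoly R[n]}) (a : 'I_n -> S) : 'I_n -> S :=
  fun i => mmap phi a (f i).

Definition surjective (A B : Type) (g : A -> B) : Prop :=
  forall b, exists a, g a = b.

(* Main.v *)
Require Import Defs.
From HB Require Import structures.
From mathcomp Require Import all_boot all_order all_algebra all_field.
From mathcomp Require Import boolp classical_sets cardinality.
From mathcomp Require Import mpoly ring.

Set Implicit Arguments.
Unset Strict Implicit.
Unset Printing Implicit Defensive.

Import Order.TTheory GRing.Theory Num.Theory.
Local Open Scope ring_scope.

(** Surjectivity passes from R to the completions by compactness: the rings
    R / m^k are finite, so approximate preimages taken in R accumulate at a
    preimage in the completion (adherent_tuple, completion_surjective).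

    For the converse, R is finitely generated over Z, since a subfield of
    characteristic zero would embed in the finite residue fields (no_subfield).
    Surjectivity on the completion at m makes f surjective, hence injective, on
    the finite set (R / m^k)^n for all k (injective_mod_pow).  The bridge from
    residue fields to generic statements is Fp_point: a finitely generated ring
    in which no positive integer vanishes has a homomorphism to some F_p.  It
    comes from a point over the algebraic numbers (algC_point), a primitive
    element theta, and a prime modulo which the minimal polynomial of theta has a
    root (schur_root).  On R such a homomorphism is reduction modulo a maximal
    ideal with residue field F_p exactly, and there f is known to be injective.

    Write f(X) - f(Y) = M (X - Y) with M a matrix over R[X, Y].  The functions
    f(X) - f(Y) and det M have no common zero over such a residue field, by
    injectivity modulo m and modulo m^2 (no_critical_point).  So some integer
    N > 0 lies in the ideal they generate, and Cramer's rule gives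
      N (X_i - Y_i) = sum_j c_ij(X, Y) (f_j(X) - f_j(Y))        (separation).
    Now fix b in R^n.  The ideal (f - b) of R[X] contains no nonzero constant, by
    Fp_point again (fiber_meets_constants), so there is a linear form lambda over
    the fractions of R on the polynomials in Y, with lambda(1) = 1, that kills
    f(Y) - b times any polynomial.  Applying lambda to the Y-part of the identity
    shows that X_i is congruent to lambda(Y_i) modulo (f - b), up to
    denominators: there are v <> 0 and u in R with v X_i - u in (f - b)
    (elimination).  This replaces the usual descent from an algebraic closure.

    It remains to see that v divides u.  Substituting in v X_i - u a solution of
    f = b modulo m^k puts u in vR + m^k, for all k and all m.  By Krull's
    intersection theorem the ideal of those c with c u in vR lies in no maximal
    ideal, so u is in vR (solution_mod_constants).  The quotients a_i = u / v
    form the preimage of b (solution). *)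

(** * Submodules, ideals and Zorn's lemma *)

Section Submodules.
Variables (A B : comNzRingType) (phi : {rmorphism A -> B}).

Definition is_submod (W : B -> Prop) : Prop :=
  [/\ W 0, forall x y, W x -> W y -> W (x + y)
    & forall a x, W x -> W (phi a * x)].

Lemma submodN W x : is_submod W -> W x -> W (- x).
Proof. by case=> _ _ WM /(WM (-1)); rewrite rmorphN1 mulN1r. Qed.

Lemma submodB W x y : is_submod W -> W x -> W y -> W (x - y).
Proof. by move=> Wm Wx /(submodN Wm); case: Wm => _ + _; apply. Qed.

Lemma submod_sum W (I : Type) (r : seq I) (P : pred I) (F : I -> B) :
  is_submod W -> (forall i, P i -> W (F i)) -> W (\sum_(i <- r | P i) F i).
Proof. by case=> W0 WD _ WF; elim/big_rec: _ => // i x /WF; apply: WD. Qed.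

Lemma submod_adjoin W g : is_submod W ->
  is_submod (fun x => exists a w, W w /\ x = w + phi a * g).
Proof.
move=> [W0 WD WM]; split.
- by exists 0, 0; rewrite rmorph0 mul0r addr0.
- move=> _ _ [a [w [Ww ->]]] [a' [w' [Ww' ->]]].
  exists (a + a'), (w + w'); split; first exact: WD.
  by rewrite rmorphD mulrDl addrACA.
move=> b _ [a [w [Ww ->]]]; exists (b * a), (phi b * w).
by split; [exact: WM | rewrite rmorphM mulrDr mulrA].
Qed.

(** The complement of a maximal submodule avoiding T is described by how far
    one has to enlarge the submodule to meet T; this single form serves for
    maximal ideals, for prime ideals avoiding the integers, and for the
    R-submodules of a polynomial ring that meet R in 0. *)
Lemma maximal_submod (I T : B -> Prop) :
  is_submod I -> (forall x, I x -> ~ T x) ->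
  exists W : B -> Prop, [/\ is_submod W, forall x, I x -> W x,
    forall x, W x -> ~ T x
    & forall g, ~ W g -> exists a w, W w /\ T (w + phi a * g)].
Proof.
move=> Im IT.
pose good (W : set B) :=
  [/\ is_submod W, forall x, I x -> W x & forall x, W x -> ~ T x].
(* The empty set is thrown in so that the empty chain has a bound. *)
pose P := [set W : set B | (forall x, ~ W x) \/ good W]%classic.
have [F FP Ftot | W [PW Wmax]] := @Zorn_bigcup B P.
  have [[X [FX [x Xx]]]|noF] :=
      pselect (exists X, F X /\ exists x, X x); last first.
    by left=> x [X FX Xx]; apply: noF; exists X; split=> //; exists x.
  have Fgood Y y : F Y -> Y y -> good Y by move=> /FP[/(_ y)|].
  have [[X0 _ _] IX _] := Fgood X x FX Xx.
  right; split.
  - split; first by exists X.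
      move=> y z [Y FY Yy] [Z FZ Zz].
      have [YZ|ZY] := Ftot _ _ FY FZ.
        by exists Z => //; case: (Fgood Z z FZ Zz) => -[_ + _] _ _; apply=> //; exact: YZ.
      by exists Y => //; case: (Fgood Y y FY Yy) => -[_ + _] _ _; apply=> //; exact: ZY.
    move=> a y [Y FY Yy]; exists Y => //.
    by case: (Fgood Y y FY Yy) => -[_ _ YM] _ _; exact: YM.
  - by move=> y Iy; exists X => //; exact: IX.
  - by move=> y [Y FY Yy]; case: (Fgood Y y FY Yy) => _ _; apply.
have gI : good I by split.
have gW : good W.
  case: PW => // W0; case: (Wmax I); last by right.
  by split=> [x /W0//|IW]; case: Im => I0 _ _; exact: (W0 0 (IW _ I0)).
case: (gW) => Wm IW WT; exists W; split=> // g Wg.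
apply: contrapT => noT.
pose V : set B := fun x => exists a w, W w /\ x = w + phi a * g.
have [W0 WD WM] := Wm.
have WV : (W `<=` V)%classic.
  by move=> x Wx; exists 0, x; rewrite rmorph0 mul0r addr0.
apply: (Wmax V).
  split=> // VW; apply/Wg/VW; exists 1, 0; rewrite rmorph1 mul1r add0r.
  by split.
right; split; first exact: submod_adjoin.
- by move=> x /IW/WV.
- by move=> _ [a [w [Ww ->]]] Tw; apply: noT; exists a, w.
Qed.

End Submodules.

Notation is_ideal := (is_submod idfun).

Definition is_subring (B : comNzRingType) (W : B -> Prop) : Prop :=
  [/\ W 1, forall x y, W x -> W y -> W (x - y)
    & forall x y, W x -> W y -> W (x * y)].

Lemma subring0 (B : comNzRingType) (W : B -> Prop) : is_subring W -> W 0.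
Proof. by case=> W1 WB _; rewrite -(subrr 1); apply: WB. Qed.

Lemma subringN (B : comNzRingType) (W : B -> Prop) x :
  is_subring W -> W x -> W (- x).
Proof. by move=> Ws; have [_ WB _] := Ws; rewrite -sub0r => Wx; apply: WB => //; exact: subring0. Qed.

Lemma subringD (B : comNzRingType) (W : B -> Prop) x y :
  is_subring W -> W x -> W y -> W (x + y).
Proof.
move=> Ws Wx /(subringN Ws) Wy; have [_ WB _] := Ws.
by rewrite -[y]opprK; apply: WB.
Qed.

Lemma subring_sum (B : comNzRingType) (W : B -> Prop) (I : Type) (r : seq I)
    (F : I -> B) :
  is_subring W -> (forall i, W (F i)) -> W (\sum_(i <- r) F i).
Proof.
move=> Ws WF; elim/big_rec: _ => [|i x _]; first exact: subring0.
exact: subringD.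
Qed.

Lemma subringX (B : comNzRingType) (W : B -> Prop) x k :
  is_subring W -> W x -> W (x ^+ k).
Proof.
by case=> W1 _ WM Wx; elim: k => // k IHk; rewrite exprS; apply: WM.
Qed.

Lemma subring_preim (A B : comNzRingType) (phi : {rmorphism A -> B})
    (W : B -> Prop) : is_subring W -> is_subring (fun x => W (phi x)).
Proof.
case=> W1 WB WM; split=> [|x y|x y]; rewrite ?(rmorph1, rmorphB, rmorphM) //.
  exact: WB.
exact: WM.
Qed.

Lemma subring_im (A B : comNzRingType) (phi : {rmorphism A -> B}) :
  is_subring (fun x => exists a, phi a = x).
Proof.
split=> [|_ _ [a <-] [b <-]|_ _ [a <-] [b <-]]; first by exists 1; rewrite rmorph1.
  by exists (a - b); rewrite rmorphB.
by exists (a * b); rewrite rmorphM.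
Qed.

(** Finite generation as a ring, put as the induction principle through which it
    is always used. *)
Definition fg (B : comNzRingType) : Prop :=
  exists L : seq B, forall W : B -> Prop,
    is_subring W -> (forall x, x \in L -> W x) -> forall x, W x.

Lemma rmorph_ideal (A B : comNzRingType) (phi : {rmorphism A -> B})
    (I : B -> Prop) : is_ideal I -> is_ideal (fun a => I (phi a)).
Proof.
case=> I0 ID IM; split=> [|x y Ix Iy|a x Ix] /=; first by rewrite rmorph0.
  by rewrite rmorphD; apply: ID.
by rewrite rmorphM; apply: IM.
Qed.

Lemma comb_ideal (B : comNzRingType) n (g : 'I_n -> B) :
  is_ideal (fun b => exists e : 'I_n -> B, b = \sum_j e j * g j).
Proof.
split=> [|_ _ [e ->] [e' ->]|a _ [e ->]].
- by exists (fun=> 0); rewrite big1 // => j _; rewrite mul0r.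
- exists (fun j => e j + e' j); rewrite -big_split; apply: eq_bigr => j _ /=.
  by rewrite mulrDl.
- exists (fun j => a * e j); rewrite mulr_sumr; apply: eq_bigr => j _.
  by rewrite mulrA.
Qed.

Lemma comb_ideal_gen (B : comNzRingType) n (g : 'I_n -> B) i :
  exists e : 'I_n -> B, g i = \sum_j e j * g j.
Proof.
exists (fun j => (j == i)%:R); rewrite (bigD1 i) //= eqxx mul1r.
by rewrite big1 ?addr0 // => j /negPf->; rewrite mul0r.
Qed.

Lemma ker_ideal (A B : comNzRingType) (phi : {rmorphism A -> B}) :
  is_ideal (fun a => phi a = 0).
Proof.
split=> [|x y xI yI|a x xI] /=; first by rewrite rmorph0.
  by rewrite rmorphD xI yI addr0.
by rewrite rmorphM xI mulr0.
Qed.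

Lemma rmorph_factor (A S C : comNzRingType) (eps : {rmorphism A -> S})
    (phi : {rmorphism A -> C}) :
  (forall x, exists a, eps a = x) -> (forall a, eps a = 0 -> phi a = 0) ->
  exists psi : {rmorphism S -> C}, forall a, psi (eps a) = phi a.
Proof.
move=> epsS ker_eps; pose lift x := projT1 (cid (epsS x)).
have liftK x : eps (lift x) = x by rewrite /lift; case: cid.
pose psi x := phi (lift x).
have phiE a b : eps a = eps b -> phi a = phi b.
  move=> eab; apply/eqP; rewrite -subr_eq0 -rmorphB; apply/eqP/ker_eps.
  by rewrite rmorphB eab subrr.
have psiB : zmod_morphism psi.
  by move=> x y; rewrite /psi -rmorphB; apply: phiE; rewrite rmorphB !liftK.
have psiM : monoid_morphism psi.
  split=> [|x y]; rewrite /psi.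
    by rewrite -[1 in RHS](rmorph1 phi); apply: phiE; rewrite liftK rmorph1.
  by rewrite -rmorphM; apply: phiE; rewrite rmorphM !liftK.
pose mB := GRing.isZmodMorphism.Build S C psi psiB.
pose mM := GRing.isMonoidMorphism.Build S C psi psiM.
pose psi' : {rmorphism S -> C} := HB.pack psi mB mM.
by exists psi' => a; apply: phiE; rewrite liftK.
Qed.

Definition poly_hom (A B : comNzRingType) (phi : {rmorphism A -> B}) (b : B) :
  {rmorphism {poly A} -> B} := horner_morph (fun a => mulrC b (phi a)).

Lemma poly_homE (A B : comNzRingType) (phi : {rmorphism A -> B}) b p :
  poly_hom phi b p = (map_poly phi p).[b].
Proof. by []. Qed.

Lemma poly_homC (A B : comNzRingType) (phi : {rmorphism A -> B}) b a :
  poly_hom phi b a%:P = phi a.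
Proof. by rewrite poly_homE map_polyC hornerC. Qed.

Lemma poly_homX (A B : comNzRingType) (phi : {rmorphism A -> B}) b :
  poly_hom phi b 'X = b.
Proof. by rewrite poly_homE map_polyX hornerX. Qed.

(** Iterated polynomial rings over A0 serve as models of finitely generated
    rings: the properties K of interest pass from A to A[X], and then to the
    rings that A maps onto.  The last clause keeps the image small, which
    matters when it has to be the ring R[mX] of Krull's theorem. *)
Lemma tower (K : comNzRingType -> Prop) (A0 B : comNzRingType)
    (rho : {rmorphism A0 -> B}) (L : seq B) :
  (forall A : comNzRingType, K A -> K {poly A}) -> K A0 ->
  exists2 A : comNzRingType, K A & exists eps : {rmorphism A -> B},
    [/\ forall a, exists a', eps a' = rho a,
        forall x, x \in L -> exists a, eps a = x
      & forall W : B -> Prop, is_subring W -> (forall a, W (rho a)) ->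
          (forall x, x \in L -> W x) -> forall a, W (eps a)].
Proof.
move=> Kpoly KA0; elim: L => [|b L [A KA [eps [eps_rho epsL epsW]]]].
  by exists A0 => //; exists rho; split=> // a; exists a.
exists {poly A}; first exact: Kpoly.
exists (poly_hom eps b); split=> [a|x|W Ws Wrho WL p].
- by have [a' <-] := eps_rho a; exists a'%:P; rewrite poly_homC.
- rewrite inE => /orP[/eqP->|/epsL[a <-]]; first by exists 'X; rewrite poly_homX.
  by exists a%:P; rewrite poly_homC.
rewrite poly_homE horner_coef; apply: subring_sum => // i.
have [_ _ WM] := Ws; apply: WM; last first.
  by apply: subringX => //; apply: WL; rewrite inE eqxx.
rewrite coef_map; apply: epsW => // x xL.
by apply: WL; rewrite inE xL orbT.
Qed.

Lemma fg_cover (K : comNzRingType -> Prop) (B : comNzRingType) :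
  (forall A : comNzRingType, K A -> K {poly A}) -> K int -> fg B ->
  exists2 A : comNzRingType, K A &
    exists eps : {rmorphism A -> B}, forall x, exists a, eps a = x.
Proof.
move=> Kpoly Kint [L Lgen].
have [A KA [eps [_ epsL _]]] := tower (intr : {rmorphism int -> B}) L Kpoly Kint.
by exists A => //; exists eps; apply: Lgen => //; exact: subring_im.
Qed.

(** * A weak Nullstellensatz over the integers *)

Lemma rmorph_poly (A S : comNzRingType) (psi : {rmorphism {poly A} -> S})
    (p : {poly A}) :
  psi p = (map_poly (psi \o polyC) p).[psi 'X].
Proof.
elim/poly_ind: p => [|p c IHp]; first by rewrite !rmorph0 horner0.
by rewrite !(rmorphD, rmorphM) /= map_polyX map_polyC !hornerE -IHp.
Qed.

(** Polynomials over A are measured by their images over S; an element of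
    minimal degree can be chosen so that its leading coefficient survives in
    S, which makes it usable as a divisor over A itself. *)
Lemma minimal_poly (A : comNzRingType) (S : idomainType) (eps : {rmorphism A -> S})
    (Q : {poly A} -> Prop) :
  (forall p q, map_poly eps p = map_poly eps q -> Q p -> Q q) ->
  (exists2 p, Q p & map_poly eps p != 0) ->
  exists g, [/\ Q g, eps (lead_coef g) != 0
    & forall r, Q r -> (size r < size g)%N -> map_poly eps r = 0].
Proof.
move=> Qmap [p0 Qp0 p0nz].
have trunc p : map_poly eps p != 0 -> Q p ->
    exists p1, [/\ Q p1, eps (lead_coef p1) != 0 & (size p1 <= size p)%N].
  move=> pnz Qp; pose d := size (map_poly eps p).
  pose p1 := \poly_(i < d) p`_i.
  have ed : eps p`_d.-1 = lead_coef (map_poly eps p) by rewrite lead_coefE coef_map.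
  have d0 : (0 < d)%N by rewrite size_poly_gt0.
  have nz : eps p`_d.-1 != 0 by rewrite ed lead_coef_eq0.
  have p1sz : size p1 = d.
    by rewrite size_poly_eq //; apply: contraNneq nz => ->; rewrite rmorph0.
  exists p1; split; last by rewrite p1sz; apply: size_poly.
    apply: Qmap Qp; apply/polyP => i; rewrite !coef_map coef_poly /=.
    case: ltnP => // di; rewrite rmorph0.
    by rewrite -coef_map nth_default.
  by rewrite lead_coefE p1sz coef_poly prednK // leqnn.
pose has d := `[< exists p, [/\ Q p, eps (lead_coef p) != 0 & size p = d] >].
have [p1 [Qp1 lp1 _]] := trunc p0 p0nz Qp0.
have ex : exists d, has d by exists (size p1); apply/asboolP; exists p1.
case: (ex_minnP ex) => d /asboolP[g [Qg lg szg]] dmin; exists g; split=> // r Qr.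
apply: contraTeq => rnz; rewrite -leqNgt szg.
have [r1 [Qr1 lr1 szr]] := trunc r rnz Qr; apply: leq_trans szr.
by apply: dmin; apply/asboolP; exists r1.
Qed.

Lemma pseudo_division (A : comNzRingType) (p h : {poly A}) : h != 0 ->
  exists e q r, lead_coef h ^+ e *: p = q * h + r /\ (size r < size h)%N.
Proof.
move=> hnz; exists (Pdiv.CommonRing.rscalp p h), (Pdiv.CommonRing.rdivp p h).
exists (Pdiv.CommonRing.rmodp p h); rewrite Pdiv.CommonRing.ltn_rmodp hnz.
by split=> //; rewrite -Pdiv.ComRing.rdivp_eq.
Qed.

(** The Nullstellensatz in a form that is inherited by polynomial rings: the
    element s stands for the finitely many denominators that the induction has
    to keep invertible. *)
Definition algC_points (A : comNzRingType) : Prop :=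
  forall (S : idomainType) (eps : {rmorphism A -> S}),
    (forall k, k.+1%:R != 0 :> S) -> forall s, eps s != 0 ->
  exists2 phi : {rmorphism A -> algC},
    forall a, eps a = 0 -> phi a = 0 & phi s != 0.

Lemma algC_points_int : algC_points int.
Proof.
move=> S eps S0 s es; exists (intr : {rmorphism int -> algC}).
  move=> a; have -> : eps a = a%:~R by rewrite -[a in LHS]intz rmorph_int.
  case: a => [[|k]|k]; rewrite ?rmorph0 //.
    by move/eqP; rewrite -pmulrn (negPf (S0 k)).
  by rewrite NegzE mulrNz => /eqP; rewrite oppr_eq0 -pmulrn (negPf (S0 k)).
by rewrite /= intr_eq0; apply: contraNneq es => ->; rewrite rmorph0.
Qed.

(** Extending a point from A to A[X] amounts to choosing the value of X.  If
    the image of X is transcendental, a value that avoids the roots of one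
    polynomial will do.  If it is algebraic, with g of minimal degree killing
    it, a root of the image of g will do; the leading coefficient of g and a
    constant multiple t of s modulo the kernel have to be kept nonzero, and
    both live in A. *)
Lemma algC_points_poly (A : comNzRingType) :
  algC_points A -> algC_points {poly A}.
Proof.
move=> ptsA S eps' S0 s es.
have [eps eps'C] : exists eps : {rmorphism A -> S}, eps =1 eps' \o polyC.
  by exists (eps' \o polyC : {rmorphism A -> S}).
have eps'E p : eps' p = (map_poly eps p).[eps' 'X].
  by rewrite rmorph_poly (eq_map_poly eps'C).
have eps'_map p q : map_poly eps p = map_poly eps q -> eps' p = eps' q.
  by rewrite (eps'E p) (eps'E q) => ->.
have [trans | ntrans] := pselect (forall p, eps' p = 0 -> map_poly eps p = 0).
  have snz : map_poly eps s != 0.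
    by apply: contraNneq es => s0; rewrite eps'E s0 horner0.
  have [j ej] : exists j, eps s`_j != 0.
    exists (size (map_poly eps s)).-1.
    by rewrite -coef_map -lead_coefE lead_coef_eq0.
  have [phi phi0 phis] := ptsA S eps S0 _ ej.
  have phisnz : map_poly phi s != 0.
    by apply: contraNneq phis => /polyP/(_ j); rewrite coef_map coef0 => /= ->.
  have [y ry] : exists y : algC, ~~ root (map_poly phi s) y.
    apply: contrapT => /forallNP allroot.
    have := @max_poly_roots _ (map_poly phi s)
      [seq i%:R | i <- iota 0 (size (map_poly phi s))] phisnz.
    rewrite size_map size_iota ltnn => H; suff: false by [].
    apply: H; first by apply/allP => x _; apply/negPn/negP/allroot.
    by rewrite map_inj_uniq ?iota_uniq //; apply: mulrIn; rewrite oner_neq0.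
  exists (poly_hom phi y) => // p /trans p0; rewrite poly_homE.
  have -> : map_poly phi p = 0; last by rewrite horner0.
  apply/polyP => i; rewrite coef_map coef0 /=; apply: phi0.
  by rewrite -coef_map p0 coef0.
have [g0 [eg0 g0nz]] : exists g0, eps' g0 = 0 /\ map_poly eps g0 != 0.
  apply: contrapT => noex; apply: ntrans => p ep; apply: contrapT => /eqP pnz.
  by apply: noex; exists p.
have [||g [eg lg gmin]] := @minimal_poly _ _ eps (fun p => eps' p = 0).
- by move=> p q /eps'_map ->.
- by exists g0.
have gnz : g != 0 by apply: contraNneq lg => ->; rewrite lead_coef0 rmorph0.
have gsz : (1 < size g)%N.
  rewrite ltnNge; apply: contra lg => /size1_polyC g_eq.
  by rewrite g_eq lead_coefC eps'C /= -g_eq eg.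
pose J p := exists a, eps' p = eps' a * eps' s.
have [||h [[a eh] lh hmin]] := @minimal_poly _ _ eps J.
- by move=> p q /eps'_map epq [a]; rewrite epq; exists a.
- by exists g0 => //; exists 0; rewrite rmorph0 mul0r.
have hnz : h != 0 by apply: contraNneq lh => ->; rewrite lead_coef0 rmorph0.
have esz p : (size (map_poly eps p) <= size p)%N by exact: size_poly.
have esz_lead p : eps (lead_coef p) != 0 -> size (map_poly eps p) = size p.
  by move=> lp; apply: size_map_poly_id0.
(* Both s and g are multiples of h over the fractions of the image of A, so an
   h of positive degree would divide the irreducible g properly. *)
have hsz : size h = 1%N.
  apply/eqP; rewrite eqn_leq size_poly_gt0 hnz andbT leqNgt; apply/negP => h1.
  have [e [q [r [gE rsz]]]] := pseudo_division g hnz.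
  have erE : eps' r = - (eps' q * eps' h).
    apply/eqP; rewrite -addr_eq0 addrC -rmorphM -rmorphD -gE.
    by rewrite -mul_polyC rmorphM eg mulr0.
  have r0 : map_poly eps r = 0.
    by apply: hmin rsz; exists (- (q * a)); rewrite erE eh rmorphN rmorphM mulNr mulrA.
  have gE' : eps (lead_coef h) ^+ e *: map_poly eps g =
             map_poly eps q * map_poly eps h.
    have /(congr1 (map_poly eps)) := gE.
    by rewrite map_polyZ rmorphD rmorphM /= r0 addr0 rmorphXn.
  have gnz' : map_poly eps g != 0 by rewrite -size_poly_gt0 (esz_lead _ lg) ltnW.
  have hgnz : map_poly eps q * map_poly eps h != 0.
    by rewrite -gE' -mul_polyC mulf_neq0 ?polyC_eq0 ?expf_neq0.
  have [qnz hnz'] : map_poly eps q != 0 /\ map_poly eps h != 0.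
    by move: hgnz; rewrite mulf_eq0 negb_or => /andP.
  have qsz : (size (map_poly eps q) < size g)%N.
    have <- : size (map_poly eps q * map_poly eps h) = size g.
      by rewrite -gE' -mul_polyC size_Cmul ?expf_neq0 // esz_lead.
    rewrite size_mul //.
    by rewrite (esz_lead _ lh); case: (size h) h1 => [|[|k]] // _; rewrite !addnS /= ltnS leq_addr.
  have : eps' q * eps' h = 0.
    apply/eqP; rewrite -oppr_eq0 -erE eps'E r0 horner0.
    by [].
  move=> /eqP; rewrite mulf_eq0 => /orP[/eqP eq0|/eqP eh0].
    pose q1 := \poly_(i < size (map_poly eps q)) q`_i.
    have q1q : map_poly eps q1 = map_poly eps q.
      apply/polyP => i; rewrite !coef_map coef_poly /=.
      case: ltnP => // di; rewrite rmorph0.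
      by rewrite -coef_map nth_default.
    move: qnz; rewrite -q1q gmin ?eqxx // ?(eps'_map _ _ q1q) //.
    exact: leq_ltn_trans (size_poly _ _) qsz.
  have [e' [q' [r' [sE rsz']]]] := pseudo_division s hnz.
  have er' : eps' r' = eps' (lead_coef h ^+ e')%:P * eps' s.
    rewrite -rmorphM mul_polyC sE rmorphD rmorphM eh0 mulr0 add0r.
    by [].
  have r0' : map_poly eps r' = 0 by apply: hmin rsz'; exists (lead_coef h ^+ e')%:P.
  move: er'; rewrite eps'E r0' horner0 => /esym/eqP.
  rewrite mulf_eq0 (negPf es) orbF -[eps' _]eps'C rmorphXn.
  by rewrite expf_eq0 (negPf lh) andbF.
have {hsz} [t hE] : exists t, h = t%:P by exists h`_0; apply: size1_polyC; rewrite hsz.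
move: lh eh; rewrite {h hmin hnz J}hE lead_coefC => et eh.
have [|phi phi0 phint] := ptsA S eps S0 (lead_coef g * t).
  by rewrite rmorphM mulf_neq0.
have [phig phit] : phi (lead_coef g) != 0 /\ phi t != 0.
  by move: phint; rewrite rmorphM mulf_eq0 negb_or => /andP.
have [y /rootP gy] : exists y, root (map_poly phi g) y.
  by apply/closed_rootP; rewrite (size_map_poly_id0 phig) gtn_eqF.
have ker p : eps' p = 0 -> poly_hom phi y p = 0.
  move=> ep; have [e [q [r [pE rsz]]]] := pseudo_division p gnz.
  have r0 : map_poly eps r = 0.
    apply: gmin rsz; apply/eqP.
    have /(congr1 eps') := pE; rewrite -mul_polyC rmorphM ep mulr0 rmorphD.
    by rewrite rmorphM eg mulr0 add0r => <-.
  have /(congr1 (poly_hom phi y)) := pE.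
  rewrite -mul_polyC rmorphM poly_homC rmorphD rmorphM (poly_homE _ _ g) gy mulr0.
  have -> : poly_hom phi y r = 0.
    rewrite poly_homE; have -> : map_poly phi r = 0; last by rewrite horner0.
    apply/polyP => i; rewrite coef_map coef0 /=; apply: phi0.
    by rewrite -coef_map r0 coef0.
  by rewrite addr0 rmorphXn => /eqP; rewrite mulf_eq0 expf_eq0 (negPf phig) andbF => /eqP.
exists (poly_hom phi y) => //.
have : poly_hom phi y (a * s - t%:P) = 0.
  by apply: ker; rewrite rmorphB rmorphM eh subrr.
rewrite rmorphB rmorphM poly_homC => /eqP; rewrite subr_eq0 => /eqP ast.
by apply: contraNneq phit => s0; rewrite -ast s0 mulr0.
Qed.

Lemma idealr_ex (R : comNzRingType) (I : R -> Prop) :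
  is_ideal I -> ~ I 1 -> exists J : idealr R, forall x, (x \in J) <-> I x.
Proof.
move=> [I0 ID IM] I1; pose S : R -> bool := fun x => `[< I x >].
have Sid : idealr_closed S.
  split; [exact/asboolP | exact/asboolP | move=> a x y /asboolP Ix /asboolP Iy].
  by apply/asboolP/ID => //; exact: (IM a).
pose J : idealr R := HB.pack S (isIdealr.Build R S Sid).
by exists J => x; split=> /asboolP.
Qed.

Lemma idealr_is_ideal (R : comNzRingType) (m : idealr R) :
  is_ideal (fun x => x \in m).
Proof.
split=> [|x y xm ym|a x xm] /=; [exact: idealr0 | exact: rpredD | exact: idealMr].
Qed.

(** A quotient ring comes without an inverse operation; units are recognized and
    inverted by choice. *)
Lemma idomain_of_comNzRing (D : comNzRingType) :
  (forall x y : D, x * y = 0 -> x = 0 \/ y = 0) ->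
  exists (S : idomainType) (eps : {rmorphism D -> S}), bijective eps.
Proof.
move=> Ddom.
pose isu (x : D) := `[< exists y, y * x = 1 >].
pose inv (x : D) := if pselect (exists y, y * x = 1) is left e
                    then projT1 (cid e) else x.
have invP : {in isu, left_inverse 1 inv *%R}.
  move=> x /asboolP ux; rewrite /inv; case: pselect => // e.
  by case: cid.
have isuP (x y : D) : y * x = 1 -> isu x by move=> yx; apply/asboolP; exists y.
have inv_out : {in [predC isu], inv =1 id}.
  by move=> x /asboolPn ux; rewrite /inv; case: pselect.
pose mU := GRing.ComNzRing_hasMulInverse.Build D invP isuP inv_out.
pose U : comUnitRingType := HB.pack D mU.
have Udom : GRing.integral_domain_axiom U.
  by move=> x y /Ddom[]->; rewrite eqxx ?orbT.
pose mD := GRing.ComUnitRing_isIntegral.Build U Udom.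
pose S : idomainType := HB.pack U mD.
by exists S, (idfun : {rmorphism D -> D}); exists id.
Qed.

Lemma domain_of_prime (B : comNzRingType) (P : B -> Prop) :
  is_ideal P -> ~ P 1 -> (forall x y, P (x * y) -> P x \/ P y) ->
  exists (S : idomainType) (pi : {rmorphism B -> S}),
    (forall x, pi x = 0 <-> P x) /\ (forall s, exists x, pi x = s).
Proof.
move=> Pid P1 Pprime; have [J JP] := idealr_ex Pid P1.
pose pi0 : {rmorphism B -> {ideal_quot J}} := \pi_({ideal_quot J})%qT.
have pi0_0 x : pi0 x = 0 <-> P x.
  rewrite -JP -[x in x \in J]subr0 (Quotient.idealrBE J).
  by rewrite -(rmorph0 pi0); split=> [->|/eqP].
have pi0S q : exists x, pi0 x = q by exists (repr q)%qT; rewrite /= reprK.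
have [|S [eps [eps' epsK eps'K]]] := @idomain_of_comNzRing {ideal_quot J}.
  move=> p q; have [[x <-] [y <-]] := (pi0S p, pi0S q).
  by rewrite -rmorphM => /pi0_0/Pprime[]/pi0_0; [left|right].
exists S, (eps \o pi0 : {rmorphism B -> S}); split=> [x|s] /=.
  rewrite -pi0_0; split=> [/(congr1 eps')|->]; last by rewrite rmorph0.
  by rewrite -(rmorph0 eps) !epsK.
by have [x xs] := pi0S (eps' s); exists x; rewrite xs eps'K.
Qed.

(** An ideal that is maximal among those containing I and no positive integer is
    prime, with a quotient of characteristic zero. *)
Lemma algC_point (B : comNzRingType) (I : B -> Prop) :
  fg B -> is_ideal I -> (forall k, ~ I k.+1%:R) ->
  exists chi : {rmorphism B -> algC}, forall x, I x -> chi x = 0.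
Proof.
move=> Bfg Iid I0; pose T (x : B) := exists k, x = k.+1%:R.
have IT x : I x -> ~ T x by move=> Ix [k xk]; apply: (I0 k); rewrite -xk.
have [P [Pid IP PT Pmax]] := maximal_submod Iid IT.
have [P0 PD PM] := Pid.
have Pprime x y : P (x * y) -> P x \/ P y.
  move=> Pxy; apply: contrapT => /not_orP[/Pmax[a [w [Pw [k wk]]]]].
  move=> /Pmax[a' [w' [Pw' [k' wk']]]]; apply: (PT (k.+1%:R * k'.+1%:R)).
    rewrite -wk -wk' /= mulrDl; apply: (PD); first by rewrite mulrC; apply: (PM).
    rewrite mulrDr; apply: (PD); first exact: PM.
    by rewrite mulrACA; apply: PM.
  by exists (k.+1 * k'.+1).-1; rewrite -natrM.
have [| //| S [pi [piP piS]]] := domain_of_prime Pid.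
  by move=> P1; apply: (PT 1) => //; exists 0%N.
have [A ptsA [eps epsS]] := fg_cover algC_points_poly algC_points_int Bfg.
have [k | | phi ker_phi _] := ptsA S (pi \o eps) _ 1.
- by apply/eqP; rewrite -(rmorph_nat pi) => /piP/PT; apply; exists k.
- by rewrite rmorph1 oner_neq0.
have [a|psi psiE] := @rmorph_factor A B algC eps phi epsS.
  by move=> ea; apply: ker_phi; rewrite /= ea rmorph0.
exists psi => x /IP Px; have [a ax] := epsS x.
by rewrite -ax psiE; apply: ker_phi; rewrite /= ax; apply/piP.
Qed.

(** * Reduction to prime fields *)

Lemma Fp_int_eq0 (p : nat) (z : int) : prime p ->
  (z%:~R == 0 :> 'F_p) = (p %| `|z|)%N.
Proof.
move=> p_pr; rewrite (dvdn_pcharf (pchar_Fp p_pr)) [in LHS](intEsign z).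
by rewrite rmorphM rmorph_sign mulf_eq0 signr_eq0.
Qed.

(** Schur's argument: if c = g(0) is not 0, then the values of g at the
    multiples of c * N are c times integers congruent to 1 mod N, and only
    finitely many of these can be 0, 1 or -1. *)
Lemma schur_root (g : {poly int}) (N : int) : (1 < size g)%N -> N != 0 ->
  exists2 p, prime p & N%:~R != 0 :> 'F_p /\
    exists y : int, g.[y]%:~R = 0 :> 'F_p.
Proof.
move=> gsz Nnz; pose c := g.[0].
have [c0 | cnz] := eqVneq c 0.
  have [p Np p_pr] := prime_above `|N|%N; exists p => //; split; last first.
    by exists 0; rewrite -/c c0.
  rewrite Fp_int_eq0 //; apply: contraL Np => pN; rewrite -leqNgt.
  by apply: dvdn_leq => //; rewrite absz_gt0.
have nz (d : int) : g - d%:P != 0.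
  apply: contraTneq gsz => /eqP; rewrite subr_eq0 => /eqP ->.
  by rewrite -leqNgt size_polyC_leq1.
pose G := g * (g - c%:P) * (g + c%:P).
have Gnz : G != 0.
  rewrite !mulf_neq0 ?nz //; last by rewrite -[c]opprK polyCN nz.
  by rewrite -[g]subr0 -polyC0 nz.
have [t Gt] : exists t : int, ~~ root G (c * N * t).
  apply: contrapT => /forallNP allroot.
  have := @max_poly_roots _ G [seq c * N * i%:Z | i <- iota 0 (size G)] Gnz.
  rewrite size_map size_iota ltnn => H; suff: false by []; apply: H.
    by apply/allP => _ /mapP[i _ ->]; apply/negPn/negP/allroot.
  rewrite map_inj_uniq ?iota_uniq // => i j /(mulfI (mulf_neq0 cnz Nnz)).
  by move=> [].
have [k gk] : exists k, g.[c * N * t] = c + c * N * t * k.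
  have /factor_theorem[q qE] : root (g - c%:P) 0.
    by apply/rootP; rewrite !hornerE subrr.
  exists q.[c * N * t]; move: (c * N * t) => z.
  have -> : g = q * ('X - 0%:P) + c%:P by rewrite -qE subrK.
  by rewrite hornerD hornerC hornerM hornerXsubC subr0 mulrC addrC.
pose u := 1 + N * t * k.
have gu : g.[c * N * t] = c * u by rewrite gk /u mulrDr mulr1 !mulrA.
have u1 : (1 < `|u|)%N.
  move: Gt; rewrite /root !hornerE gu.
  case uE: `|u|%N => [|[|//]].
    by move/eqP: uE; rewrite absz_eq0 => /eqP->; rewrite mulr0 !mul0r eqxx.
  have /orP[/eqP->|/eqP->] : (u == 1) || (u == -1).
    by move: uE; case: (u) => [[|[|?]]|[|?]].
    by rewrite mulr1 subrr mulr0 mul0r eqxx.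
  by rewrite mulrN1 addNr mulr0 eqxx.
exists (pdiv `|u|); first exact: pdiv_prime.
have p_pr := pdiv_prime u1; have p_u := pdiv_dvd `|u|.
have u0 : u%:~R = 0 :> 'F_(pdiv `|u|) by apply/eqP; rewrite Fp_int_eq0.
split; last by exists (c * N * t); rewrite gu intrM u0 mulr0.
apply/eqP => N0; move/eqP: u0.
by rewrite intrD !intrM N0 !mul0r addr0 oner_eq0.
Qed.

Lemma common_multiplier (F : fieldType) (Q : F -> Prop) (L : seq F) :
  (forall (a : int) x, Q x -> Q (a%:~R * x)) ->
  (forall x, x \in L -> exists2 a : int, a != 0 & Q (a%:~R * x)) ->
  exists2 N : int, N != 0 & forall x, x \in L -> Q (N%:~R * x).
Proof.
move=> Qm; elim: L => [|x L IHL] QL; first by exists 1.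
have [y yL|N Nnz QN] := IHL; first by apply: QL; rewrite inE yL orbT.
have [|a anz Qa] := QL x; first by rewrite inE eqxx.
exists (a * N) => [|y]; first by rewrite mulf_neq0.
rewrite inE intrM => /orP[/eqP->|/QN]; last by rewrite -mulrA; apply: Qm.
by rewrite -mulrA mulrCA; apply: Qm.
Qed.

(** Minimality is wanted among integral polynomials, because pseudo-division by g
    stays in Z[T] and can be reduced modulo p. *)
Lemma int_minimal_poly (theta : algC) :
  exists g : {poly int}, [/\ (1 < size g)%N, (map_poly intr g).[theta] = 0
    & forall r : {poly int}, (map_poly intr r).[theta] = 0 ->
        (size r < size g)%N -> r = 0].
Proof.
have [q [qE qm q_dvd]] := minCpolyP theta.
have [g [a anz gE]] := rat_poly_scale q.
have map2 (r : {poly int}) : map_poly ratr (map_poly intr r) = map_poly intr r :> {poly algC}.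
  by rewrite -map_poly_comp; apply: eq_map_poly => z /=; rewrite ratr_int.
have gq : map_poly intr g = a%:~R *: q.
  by rewrite gE scalerA mulfV ?scale1r // intr_eq0.
have gsz : size g = size q.
  by rewrite -(size_rat_int_poly g) gq size_scale // intr_eq0.
exists g; split.
- by rewrite gsz; have := size_minCpoly theta; rewrite qE size_map_poly.
- rewrite -map2; apply/rootP; rewrite q_dvd gq dvdpZr ?dvdpp //.
  by rewrite intr_eq0.
move=> r /rootP; rewrite -map2 q_dvd gsz -(size_rat_int_poly r) => qr szr.
apply/eqP; rewrite -size_poly_eq0 -(size_rat_int_poly r) size_poly_eq0.
by apply: contraLR szr => rnz; rewrite -leqNgt; apply: dvdp_leq.
Qed.

(** By the primitive element theorem the image of chi lies in Z[1/N][theta] for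
    one algebraic number theta.  Schur's argument provides a prime p modulo which
    a minimal polynomial of theta has a root y, and theta is sent to y. *)
Lemma Fp_point_of_algC (B : comNzRingType) (chi : {rmorphism B -> algC}) :
  fg B -> exists2 p, prime p & exists psi : {rmorphism B -> 'F_p},
    forall x, chi x = 0 -> psi x = 0.
Proof.
move=> [L Lgen].
have [theta [_ _] [ps psE]] := algC_PET [seq chi x | x <- L].
pose at_theta : {rmorphism {poly int} -> algC} :=
  poly_hom (intr : {rmorphism int -> algC}) theta.
have at_thetaC z : at_theta z%:P = z%:~R by exact: poly_homC.
have [|x xL|N Nnz NL] := @common_multiplier algC
    (fun x => exists H, x = at_theta H) [seq chi x | x <- L].
- by move=> a x [H ->]; exists (a%:P * H); rewrite rmorphM at_thetaC.
- move: xL; rewrite psE => /mapP[q _ ->].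
  have [H [a anz qE]] := rat_poly_scale q; exists a => //; exists H.
  rewrite qE map_polyZ hornerZ fmorphV /= ratr_int mulrA mulfV ?intr_eq0 // mul1r.
  rewrite -map_poly_comp; congr _.[_].
  by apply: eq_map_poly => z /=; rewrite ratr_int.
have [g [gsz g0 gmin]] := int_minimal_poly theta.
have gnz : g != 0 by rewrite -size_poly_gt0 ltnW.
have [|p p_pr [Nlnz [y gy]]] := @schur_root g (N * lead_coef g) gsz.
  by rewrite mulf_neq0 // lead_coef_eq0.
move: Nlnz; rewrite intrM mulf_eq0 negb_or => /andP[Np lp].
pose at_y : {rmorphism {poly int} -> 'F_p} :=
  poly_hom (intr : {rmorphism int -> 'F_p}) y%:~R.
have at_yC z : at_y z%:P = z%:~R by exact: poly_homC.
have gy0 : at_y g = 0 by rewrite -[RHS]gy /at_y poly_homE horner_map.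
have theta_y H : at_theta H = 0 -> at_y H = 0.
  move=> H0; have [e [q [r [HE rsz]]]] := pseudo_division H gnz.
  have r0 : r = 0.
    apply: gmin rsz; have /(congr1 at_theta) := HE.
    rewrite -mul_polyC !(rmorphM, rmorphD) H0 mulr0.
    by rewrite [at_theta g]g0 mulr0 add0r => /esym.
  have /(congr1 at_y) := HE.
  rewrite r0 addr0 -mul_polyC !rmorphM gy0 mulr0 at_yC rmorphXn => /eqP.
  by rewrite mulf_eq0 expf_eq0 (negPf lp) andbF => /eqP.
(* As 1/N lies in both targets, values are compared after clearing powers of N
   rather than inside Z[1/N]. *)
pose rel b v := exists D H, N%:~R ^+ D * chi b = at_theta H
                            /\ N%:~R ^+ D * v = at_y H.
have rel1 : rel 1 1 by exists 0%N, 1; rewrite !rmorph1 !mulr1 expr0.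
have relB b v b' v' : rel b v -> rel b' v' -> rel (b - b') (v - v').
  move=> [D [H [bH vH]]] [D' [H' [bH' vH']]].
  exists (D + D')%N, (N%:P ^+ D' * H - N%:P ^+ D * H').
  rewrite !rmorphB !rmorphM !rmorphXn !at_thetaC !at_yC -bH -bH' -vH -vH' !exprD.
  by rewrite !mulrBr !mulrA [X in X * chi b]mulrC [X in X * v]mulrC.
have relM b v b' v' : rel b v -> rel b' v' -> rel (b * b') (v * v').
  move=> [D [H [bH vH]]] [D' [H' [bH' vH']]].
  exists (D + D')%N, (H * H').
  by rewrite !rmorphM -bH -bH' -vH -vH' !exprD !mulrA ![_ * N%:~R ^+ D' * _]mulrAC.
have rel_ex b : exists v, rel b v.
  apply: (Lgen (fun b => exists v, rel b v)) => [|x xL]; first split.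
  - by exists 1.
  - by move=> b1 b2 [v1 r1] [v2 r2]; exists (v1 - v2); apply: relB.
  - by move=> b1 b2 [v1 r1] [v2 r2]; exists (v1 * v2); apply: relM.
  have [H NH] := NL (chi x) (map_f _ xL).
  by exists (N%:~R^-1 * at_y H), 1%N, H; rewrite !expr1 mulrA mulfV ?mul1r.
have rel0 b v : rel b v -> chi b = 0 -> v = 0.
  move=> [D [H [bH vH]]] b0; move: vH; rewrite theta_y -?bH ?b0 ?mulr0 //.
  by move/eqP; rewrite mulf_eq0 expf_eq0 (negPf Np) andbF => /eqP.
have rel_fun b v v' : rel b v -> rel b v' -> v = v'.
  move=> r r'; apply/eqP; rewrite -subr_eq0; apply/eqP.
  by apply: (rel0 _ _ (relB _ _ _ _ r r')); rewrite subrr rmorph0.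
pose psi b := projT1 (cid (rel_ex b)).
have psiP b : rel b (psi b) by rewrite /psi; case: cid.
have psiB : zmod_morphism psi.
  by move=> b b'; apply: rel_fun (psiP _) _; apply: relB.
have psiM : monoid_morphism psi.
  by split=> [|b b']; apply: rel_fun (psiP _) _ => //; apply: relM.
pose psi' : {rmorphism B -> 'F_p} :=
  HB.pack psi (GRing.isZmodMorphism.Build B 'F_p psi psiB)
              (GRing.isMonoidMorphism.Build B 'F_p psi psiM).
by exists p => //; exists psi' => b; apply: rel0.
Qed.

(** A finitely generated ring has a point with values in a prime field as soon
    as its integers survive.  That the residue field is a prime field, and not
    just a finite one, is what later allows the point to be seen as a point
    over a residue field of any given subring. *)
Lemma Fp_point (B : comNzRingType) (I : B -> Prop) :
  fg B -> is_ideal I -> (forall k, ~ I k.+1%:R) ->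
  exists2 p, prime p & exists psi : {rmorphism B -> 'F_p},
    forall x, I x -> psi x = 0.
Proof.
move=> Bfg Iid I0; have [chi chi0] := algC_point Bfg Iid I0.
have [p p_pr [psi psi0]] := Fp_point_of_algC chi Bfg.
by exists p => //; exists psi => x /chi0/psi0.
Qed.

(** * Noetherian rings: Hilbert's basis theorem and Krull's intersection theorem *)

Definition noetherian (A : comNzRingType) : Prop :=
  forall J : nat -> A -> Prop, (forall k, is_ideal (J k)) ->
    (forall k x, J k x -> J k.+1 x) -> exists k, forall j x, J j x -> J k x.

Lemma chain_mono (T : Type) (J : nat -> T -> Prop) :
  (forall k x, J k x -> J k.+1 x) ->
  forall i j x, (i <= j)%N -> J i x -> J j x.
Proof.
move=> JS i j x /subnKC <-; elim: (j - i)%N => [|d IHd] Jx; first by rewrite addn0.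
by rewrite addnS; apply/JS/IHd.
Qed.

Lemma uniform_bound (n : nat) (P : nat -> nat -> Prop) :
  (forall i k k', (k <= k')%N -> P i k -> P i k') ->
  (forall i, (i < n)%N -> exists k, P i k) ->
  exists k, forall i, (i < n)%N -> P i k.
Proof.
move=> Pmono; elim: n => [|n IHn] Pex; first by exists 0%N.
have [i lt_in|k Pk] := IHn; first by apply/Pex/ltnW.
have [k' Pk'] := Pex n (ltnSn n); exists (maxn k k') => i; rewrite ltnS leq_eqVlt.
case/orP=> [/eqP->|/Pk]; first exact: Pmono (leq_maxr _ _) Pk'.
exact: Pmono (leq_maxl _ _).
Qed.

Lemma noetherian_im (A B : comNzRingType) (eps : {rmorphism A -> B}) :
  (forall x, exists a, eps a = x) -> noetherian A -> noetherian B.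
Proof.
move=> epsS noeA J Jid JS.
have [k|k a|k kP] := noeA (fun k a => J k (eps a)); [exact: rmorph_ideal | exact: JS |].
by exists k => j x; have [a <-] := epsS x; apply: kP.
Qed.

Lemma noetherian_int : noetherian int.
Proof.
move=> J Jid JS; have Jmono := chain_mono JS.
have [[k0 [z [Jz znz]]]|zero] := pselect (exists k z, J k z /\ z != 0); last first.
  exists 0%N => j x Jx; have [->|xnz] := eqVneq x 0; first by case: (Jid 0%N).
  by case: zero; exists j, x.
have [||k kP] := @uniform_bound `|z|
    (fun r k => forall j, J j r%:Z -> J k r%:Z).
- by move=> r k k' kk' Pk j /Pk; apply: Jmono.
- move=> r _; have [[j Jr]|none] := pselect (exists j, J j r%:Z).
    by exists j.
  by exists 0%N => j Jr; case: none; exists j.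
exists (maxn k k0) => j x Jx; rewrite (divz_eq x z).
have Jz' : J (maxn k k0) z by apply: Jmono Jz; apply: leq_maxr.
have [_ JD JM] := Jid (maxn k k0); apply: (JD); first exact: (JM).
have /gez0_abs <- : (0 <= x %% z)%Z by rewrite modz_ge0.
have lt_r : (`|(x %% z)%Z| < `|z|)%N.
  by rewrite -ltz_nat gez0_abs ?modz_ge0 // ltz_mod.
apply: (Jmono k); first exact: leq_maxl.
apply: (kP _ lt_r (maxn j k0)); rewrite gez0_abs ?modz_ge0 //.
have -> : (x %% z)%Z = x + (- (x %/ z)%Z) * z.
  by rewrite {2}(divz_eq x z) mulNr addrAC subrr add0r.
have [_ JD' JM'] := Jid (maxn j k0); apply: (JD').
  by apply: Jmono Jx; apply: leq_maxl.
by apply: (JM'); apply: Jmono Jz; apply: leq_maxr.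
Qed.

(** Hilbert's basis theorem, in terms of chains: the ideals of leading
    coefficients in degree d of the k-th ideal increase with both d and k, so
    their diagonal stabilizes, and so do the finitely many rows of small
    degree. *)
Lemma noetherian_poly (A : comNzRingType) :
  noetherian A -> noetherian {poly A}.
Proof.
move=> noeA J Jid JS; have Jmono := chain_mono JS.
pose L k d a := exists p, [/\ J k p, (size p <= d.+1)%N & p`_d = a].
have Lid k d : is_ideal (L k d).
  have [J0 JD JM] := Jid k; split.
  - by exists 0; rewrite size_poly0 coef0.
  - move=> _ _ [p [Jp psz <-]] [q [Jq qsz <-]]; exists (p + q); split.
    + exact: JD.
    + by rewrite (leq_trans (size_polyD _ _)) // geq_max psz.
    + by rewrite coefD.
  - move=> a _ [p [Jp psz <-]]; exists (a%:P * p); split; first exact: JM.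
      by rewrite mul_polyC (leq_trans (size_scale_leq _ _)).
    by rewrite coefCM.
have LSk k d a : L k d a -> L k.+1 d a.
  by move=> [p [Jp psz pd]]; exists p; split=> //; apply: JS.
have LSd k d a : L k d a -> L k d.+1 a.
  move=> [p [Jp psz <-]]; exists ('X * p); split.
  - by case: (Jid k) => _ _; apply.
  - rewrite (leq_trans (size_polyMleq _ _)) // size_polyX /=.
    by rewrite ltnS.
  - by rewrite coefXM.
have Lk k k' d a : (k <= k')%N -> L k d a -> L k' d a.
  by apply: (chain_mono (J := fun k => L k d)) => *; apply: LSk.
have Ld k d d' a : (d <= d')%N -> L k d a -> L k d' a.
  by apply: (chain_mono (J := L k)) => *; apply: LSd.
have [k|k a|n0 n0P] := noeA (fun k => L k k).
- exact: Lid.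
- by move=> /LSk/LSd.
have [||n1 n1P] := @uniform_bound n0 (fun d k => forall j a, L j d a -> L k d a).
- by move=> d k k' kk' Pk j a /Pk; apply: Lk.
- by move=> d _; apply: noeA => [k|k a]; [exact: Lid | exact: LSk].
pose K := maxn n0 n1; exists K => j p Jp.
have [e] := ubnP (size p); elim: e => // e IHe in j p Jp *; rewrite ltnS => psz.
have [JK0 JKD JKM] := Jid K.
have [->|pnz] := eqVneq p 0; first exact: JK0.
have [d dE] : exists d, size p = d.+1.
  by exists (size p).-1; rewrite prednK // size_poly_gt0.
have Lpd : L j d p`_d by exists p; rewrite dE.
have [q [JKq qsz qd]] : L K d p`_d.
  have [lt_d|ge_d] := ltnP d n0.
    exact: Lk (leq_maxr n0 n1) (n1P d lt_d _ _ Lpd).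
  apply: (Ld) ge_d _; apply: (Lk) (leq_maxl n0 n1) _; apply: (n0P (maxn j d)).
  exact: Lk (leq_maxl _ _) (Ld _ _ _ _ (leq_maxr _ _) Lpd).
have -> : p = (p - q) + q by rewrite subrK.
apply: (JKD) => //; apply: (IHe (maxn j K)).
  apply: submodB (Jid _) _ _; first by apply: Jmono Jp; apply: leq_maxl.
  by apply: Jmono JKq; apply: leq_maxr.
move: psz; rewrite dE; apply: leq_trans; rewrite ltnS.
apply/leq_sizeP => i; rewrite leq_eqVlt coefB => /orP[/eqP<-|lt_di].
  by rewrite qd subrr.
by rewrite !nth_default ?subrr ?dE //; apply: leq_trans qsz _.
Qed.

Lemma noetherian_fg (B : comNzRingType) : fg B -> noetherian B.
Proof.
move=> /(fg_cover noetherian_poly noetherian_int)[A noeA [eps epsS]].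
exact: noetherian_im epsS noeA.
Qed.

Fixpoint span (A : comNzRingType) (s : seq A) (x : A) : Prop :=
  if s is a :: s' then exists c y, span s' y /\ x = c * a + y else x = 0.

Lemma span_ideal (A : comNzRingType) (s : seq A) : is_ideal (span s).
Proof.
elim: s => [|a s [s0 sD sM]]; split=> /=.
- by [].
- by move=> _ _ -> ->; rewrite addr0.
- by move=> b _ ->; rewrite mulr0.
- by exists 0, 0; rewrite mul0r addr0.
- move=> _ _ [c [y [sy ->]]] [c' [y' [sy' ->]]].
  by exists (c + c'), (y + y'); split; [exact: sD | rewrite mulrDl addrACA].
move=> b _ [c [y [sy ->]]]; exists (b * c), (b * y).
by split; [exact: sM | rewrite mulrDr mulrA].
Qed.

Lemma mem_span (A : comNzRingType) (s : seq A) x : x \in s -> span s x.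
Proof.
elim: s => //= a s IHs; rewrite inE => /orP[/eqP->|/IHs sx].
  by exists 1, 0; rewrite mul1r addr0; split=> //; case: (span_ideal s).
by exists 0, x; rewrite mul0r add0r.
Qed.

Lemma noetherian_span (A : comNzRingType) (I : A -> Prop) :
  noetherian A -> is_ideal I ->
  exists2 s : seq A, forall x, x \in s -> I x & forall x, I x -> span s x.
Proof.
move=> noeA Iid; apply: contrapT => nfg.
have next (s : seq A) : exists x, (forall y, y \in s -> I y) -> I x /\ ~ span s x.
  have [sI|nsI] := pselect (forall y, y \in s -> I y); last by exists 0.
  apply: contrapT => nx; apply: nfg; exists s => // x Ix.
  by apply: contrapT => nsx; apply: nx; exists x.
pose G k := iter k (fun s => projT1 (cid (next s)) :: s) [::].
have GP k : (forall y, y \in G k -> I y) ->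
    I (projT1 (cid (next (G k)))) /\ ~ span (G k) (projT1 (cid (next (G k)))).
  by case: cid.
have GI k : forall y, y \in G k -> I y.
  elim: k => // k IHk y; rewrite /= inE => /orP[/eqP->|/IHk //].
  by case: (GP k IHk).
have [k|k x Gx|k kP] := noeA (fun k => span (G k)).
- exact: span_ideal.
- by exists 0, x; rewrite mul0r add0r.
have [_] := GP k (GI k); apply; apply: (kP k.+1); apply: mem_span.
by rewrite /= inE eqxx.
Qed.

Lemma ideal_pow_ideal (R : comNzRingType) (m : idealr R) k :
  is_ideal (fun x => x \in ideal_pow m k).
Proof. by case: k => [|k] //; apply: (idealr_is_ideal (ideal_powS m k)). Qed.

Lemma ideal_powM (R : comNzRingType) (m : idealr R) k x y :
  x \in m -> y \in ideal_pow m k -> x * y \in ideal_pow m k.+1.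
Proof.
by move=> xm yk; apply/ideal_powSP; exists [:: (x, y)]; rewrite ?big_seq1 //= xm yk.
Qed.

(** Krull's intersection theorem, modulo an ideal Q.  The elements y_k X^k, with
    y_k in m^k congruent to u modulo Q, all lie in the noetherian ring R[mX].
    Some y_K X^K is a combination of the previous ones, and comparing
    the coefficients of X^K expresses u modulo Q as a multiple of u by an
    element of m. *)
Theorem krull_intersection (R : comNzRingType) (m : idealr R) (Q : R -> Prop) u :
  noetherian R -> is_ideal Q ->
  (forall k, exists2 y, y \in ideal_pow m k & Q (u - y)) ->
  exists2 c, c \in m & Q ((1 - c) * u).
Proof.
move=> noeR Qid uP; have [Q0 QD QM] := Qid.
have [s sm m_span] := noetherian_span noeR (idealr_is_ideal m).
have [B noeB [eps [epsC epsX epsW]]] :=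
  tower (polyC : {rmorphism R -> {poly R}}) [seq c%:P * 'X | c <- s]
        noetherian_poly noeR.
have eps_m c : c \in m -> exists a, eps a = c%:P * 'X.
  move/m_span; elim: s {sm m_span epsW} epsX c => [|b s IHs] epsX c /=.
    by move=> ->; exists 0; rewrite rmorph0 mul0r.
  have {}IHs y : span s y -> exists a, eps a = y%:P * 'X.
    by apply: IHs => x xs; apply: epsX; rewrite inE xs orbT.
  move=> [d [y [/IHs[a' aE] ->]]].
  have [|a bE] := epsX (b%:P * 'X); first by rewrite inE eqxx.
  have [d' dE] := epsC d; exists (d' * a + a').
  by rewrite rmorphD rmorphM bE aE dE rmorphD rmorphM mulrDl mulrA.
have eps_pow k y : y \in ideal_pow m k -> exists a, eps a = y%:P * 'X^k.
  elim: k y => [|k IHk] y; first by have [a aE] := epsC y; exists a; rewrite expr0 mulr1.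
  case/ideal_powSP => r /allP rP ->; elim: r rP => [|[v w] r IHr] rP.
    by exists 0; rewrite big_nil rmorph0 mul0r.
  have [x xr|a aE] := IHr; first by apply: rP; rewrite inE xr orbT.
  have /andP[/= /eps_m[b bE] /IHk[b' bE']] : (v \in m) && (w \in ideal_pow m k).
    by apply: (rP (v, w)); rewrite inE eqxx.
  exists (b * b' + a); rewrite rmorphD rmorphM aE bE bE' big_cons rmorphD rmorphM.
  by rewrite mulrDl exprS mulrACA.
have eps_coef a j : (0 < j)%N -> (eps a)`_j \in m.
  move: j; apply: (epsW (fun q => forall j, (0 < j)%N -> q`_j \in m)).
  - split=> [j|p q pP qP j j0|p q pP qP j j0]; rewrite ?coef1 ?coefB.
    + by move=> j0; rewrite gtn_eqF ?idealr0.
    + by rewrite rpredB ?pP ?qP.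
    + rewrite coefM rpred_sum // => i _; case: (posnP i) => [i0|i0].
        by rewrite idealMr // qP // i0 subn0.
      by rewrite mulrC idealMr // pP.
  - by move=> r j j0; rewrite coefC gtn_eqF ?idealr0.
  - move=> _ /mapP[c cs ->] j j0; rewrite coefCM coefX.
    by rewrite mulrC idealMr //; apply: sm.
pose J k z := exists w : {poly R}, (forall j, Q (eps z - u%:P * w)`_j) /\
                                   (forall j, (k <= j)%N -> w`_j \in m).
have [k|k z [w [zw wm]]|K KP] := noeB J.
- split.
  + exists 0; split=> j; rewrite ?rmorph0 ?mulr0 ?subrr ?coef0 ?idealr0 //.
  + move=> z z' [w [zw wm]] [w' [zw' wm']]; exists (w + w'); split=> j.
      by rewrite rmorphD mulrDr opprD addrACA coefD; apply: QD.
    by move=> kj; rewrite coefD rpredD ?wm ?wm'.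
  + move=> a z [w [zw wm]]; exists (eps a * w); split=> j.
      rewrite rmorphM mulrCA -mulrBr coefM; apply: (submod_sum _ Qid) => i _.
      exact: QM.
    move=> kj; rewrite coefM rpred_sum // => i _.
    case: (posnP i) => [->|i0]; first by rewrite subn0 idealMr ?wm.
    by rewrite mulrC idealMr // eps_coef.
- by exists w; split=> // j kj; apply/wm/ltnW.
have [y yK Quy] := uP K; have [z zE] := eps_pow K y yK.
have [|w [zw wm]] := KP K.+1 z.
  exists 'X^K; split=> j.
    rewrite zE -mulrBl -rmorphB coefCM coefXn mulrC.
    by apply: QM; rewrite -opprB; exact: submodN Qid Quy.
  by move=> Kj; rewrite coefXn gtn_eqF ?idealr0.
exists w`_K; first exact: wm.
have := QD _ _ (zw K) Quy; rewrite zE coefB coefCM coefXn eqxx mulr1 coefCM.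
by rewrite addrC subrKA mulrBl mul1r mulrC.
Qed.

(** By induction on k: each m^k is finitely generated, so m^k / m^(k+1) is a
    finitely generated module over the finite ring R / m. *)
Lemma finite_ideal_pow (R : comNzRingType) (m : idealr R) :
  noetherian R -> (exists s : seq R, forall x, exists2 t, t \in s & x - t \in m) ->
  forall k, exists s : seq R, forall x,
    exists2 t, t \in s & x - t \in ideal_pow m k.
Proof.
move=> noeR [s sP]; elim=> [|k [S SP]].
  by exists [:: 0] => x; exists 0; rewrite ?inE.
have [g gk k_span] := noetherian_span noeR (ideal_pow_ideal m k).
have [T TP] : exists T : seq R, forall y, span g y ->
    exists2 t, t \in T & y - t \in ideal_pow m k.+1.
  elim: g gk {k_span} => [|a g IHg] gk.
    exists [:: 0] => y ->; exists 0; first by rewrite inE.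
    by rewrite subrr; have [] := ideal_pow_ideal m k.+1.
  have [x xg|T TP] := IHg; first by apply: gk; rewrite inE xg orbT.
  exists [seq t * a + t' | t <- s, t' <- T] => _ [c [y [/TP[t' t'T yt'] ->]]].
  have [t ts ct] := sP c; exists (t * a + t'); first exact: allpairs_f.
  rewrite opprD addrACA -mulrBl; case: (ideal_pow_ideal m k.+1) => _ + _; apply=> //.
  by apply: ideal_powM => //; apply: gk; rewrite inE eqxx.
exists [seq t + t' | t <- S, t' <- T] => x.
have [t tS xt] := SP x; have [t' t'T xtt'] := TP _ (k_span _ xt).
by exists (t + t'); [exact: allpairs_f | rewrite opprD addrA].
Qed.

(** * Evaluation of polynomial maps *)

Lemma mpoly_gen (R : comNzRingType) n (W : {mpoly R[n]} -> Prop) :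
  is_subring W -> (forall c, W c%:MP) -> (forall i, W 'X_i) -> forall h, W h.
Proof.
move=> Ws WC WX h; have [W1 _ WM] := Ws.
rewrite (mpolyE h); apply: subring_sum => // m.
rewrite -mul_mpolyC; apply: (WM); first exact: WC.
rewrite mpolyXE_id; elim/big_rec: _ => // i x _ Wx.
by apply: (WM) => //; apply: subringX.
Qed.

Lemma mpoly_hom_ext (R C : comNzRingType) n
    (chi1 chi2 : {rmorphism {mpoly R[n]} -> C}) :
  (forall c, chi1 c%:MP = chi2 c%:MP) -> (forall i, chi1 'X_i = chi2 'X_i) ->
  chi1 =1 chi2.
Proof.
move=> eqC eqX; apply: mpoly_gen => //; split=> [|x y xE yE|x y xE yE].
- by rewrite !rmorph1.
- by rewrite !rmorphB xE yE.
- by rewrite !rmorphM xE yE.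
Qed.

Lemma fg_mpoly (R : comNzRingType) n : fg R -> fg {mpoly R[n]}.
Proof.
move=> [L Lgen].
exists ([seq c%:MP | c <- L] ++ [seq 'X_i | i <- enum 'I_n]) => W Ws WL.
apply: mpoly_gen => // [c|i]; last first.
  by apply: WL; rewrite mem_cat; apply/orP; right; apply: map_f; rewrite mem_enum.
apply: (Lgen (fun c => W c%:MP)) => [|x xL].
  exact: (@subring_preim _ _ (@mpolyC n R : {rmorphism R -> {mpoly R[n]}})).
by apply: WL; rewrite mem_cat; apply/orP; left; apply: (map_f (@mpolyC n R)).
Qed.

Section Evaluation.
Variables (R C : comNzRingType) (n : nat) (phi : {rmorphism R -> C}).

Lemma mmap_var (a : 'I_n -> C) i : mmap phi a 'X_i = a i.
Proof. by rewrite mmapX mmap1U. Qed.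

Lemma rmorph_mmap (D : comNzRingType) (psi : {rmorphism C -> D})
    (rho : {rmorphism R -> D}) (a : 'I_n -> C) (b : 'I_n -> D) h :
  (forall c, psi (phi c) = rho c) -> (forall i, psi (a i) = b i) ->
  psi (mmap phi a h) = mmap rho b h.
Proof.
move=> eqC eqX; pose chi1 : {rmorphism {mpoly R[n]} -> D} := psi \o mmap phi a.
apply: (@mpoly_hom_ext R D n chi1 (mmap rho b)) => [c|i] /=.
  by rewrite !mmapC eqC.
by rewrite !mmapX !mmap1U eqX.
Qed.

(** The M j are difference quotients: for several polynomials h they form a
    matrix that restricts to the Jacobian matrix on the diagonal, so that no
    derivative has to be mentioned. *)
Lemma mmap_diff (x y : 'I_n -> C) (h : {mpoly R[n]}) :
  exists M : 'I_n -> C,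
    mmap phi x h - mmap phi y h = \sum_j M j * (x j - y j).
Proof.
move: h; apply: mpoly_gen => [|c|i]; first split.
- by exists (fun=> 0); rewrite !rmorph1 subrr big1 // => j _; rewrite mul0r.
- move=> h1 h2 [M1 E1] [M2 E2]; exists (fun j => M1 j - M2 j).
  rewrite (eq_bigr _ (fun j _ => mulrBl _ _ _)) sumrB -E1 -E2 !rmorphB.
  ring.
- move=> h1 h2 [M1 E1] [M2 E2].
  exists (fun j => mmap phi x h1 * M2 j + mmap phi y h2 * M1 j).
  transitivity (mmap phi x h1 * \sum_j M2 j * (x j - y j) +
                mmap phi y h2 * \sum_j M1 j * (x j - y j)).
    by rewrite -E1 -E2 !rmorphM; ring.
  rewrite !mulr_sumr -big_split; apply: eq_bigr => j _.
  by rewrite mulrDl !mulrA.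
- by exists (fun=> 0); rewrite !mmapC subrr big1 // => j _; rewrite mul0r.
exists (fun j => (j == i)%:R); rewrite !mmap_var (bigD1 i) //= eqxx mul1r.
by rewrite big1 ?addr0 // => j /negPf->; rewrite mul0r.
Qed.

End Evaluation.

Lemma mmap_mod (R C : comNzRingType) n (phi : {rmorphism R -> C})
    (I : C -> Prop) (x y : 'I_n -> C) h :
  is_ideal I -> (forall j, I (x j - y j)) -> I (mmap phi x h - mmap phi y h).
Proof.
move=> Iid Ixy; have [M ->] := mmap_diff phi x y h.
by apply: (submod_sum _ Iid) => j _; case: Iid => _ _; apply.
Qed.

(** * Polynomial maps modulo powers of a maximal ideal *)

Lemma finite_reps (R : comNzRingType) (m : idealr R) :
  finite_set [set: {ideal_quot m}]%classic ->
  exists s : seq R, forall x, exists2 t, t \in s & x - t \in m.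
Proof.
move=> /finite_seqP[s sE]; exists [seq (repr q)%qT | q <- s] => x.
pose q : {ideal_quot m} := (\pi_({ideal_quot m}) x)%qT.
have qs : q \in s by have /seteqP[+ _] := sE; apply.
exists (repr q)%qT; first exact: map_f.
by rewrite (Quotient.idealrBE m) reprK.
Qed.

(** A surjective self-map of a finite set is injective; here the finite set is
    the set of n-tuples modulo the ideal I. *)
Lemma surjective_mod_injective (R : comNzRingType) n (I : R -> Prop)
    (s : seq R) (F : ('I_n -> R) -> ('I_n -> R)) :
  is_ideal I -> (forall x, exists2 t, t \in s & I (x - t)) ->
  (forall x y, (forall i, I (x i - y i)) -> forall i, I (F x i - F y i)) ->
  (forall b, exists a, forall i, I (F a i - b i)) ->
  forall x y, (forall i, I (F x i - F y i)) -> forall i, I (x i - y i).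
Proof.
move=> Iid sP Fmod Fsurj; have [I0 ID IM] := Iid.
have Isym x y : I (x - y) -> I (y - x) by rewrite -opprB => /(submodN Iid); rewrite opprK.
have Itr y x z : I (x - y) -> I (y - z) -> I (x - z).
  by move=> xy /(ID _ _ xy); rewrite addrA subrK.
pose N := size s; pose idx x := find (fun t => `[< I (x - t) >]) s.
have idx_has x : has (fun t => `[< I (x - t) >]) s.
  by have [t ts xt] := sP x; apply/hasP; exists t => //; apply/asboolP.
have idx_lt x : (idx x < N)%N by rewrite -has_find idx_has.
pose ix x : 'I_N := Ordinal (idx_lt x).
have idxP x : I (x - s`_(ix x)).
  by have /asboolP := nth_find 0 (idx_has x).
have ix_eq x y : (ix x = ix y) <-> I (x - y).
  split=> [xy|xy]; first by apply: (Itr s`_(ix x)) => //; rewrite xy; apply: Isym.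
  apply: val_inj; apply: eq_find => t; apply/asboolP/asboolP => [xt|yt].
    by apply: (Itr x) => //; apply: Isym.
  exact: (Itr y).
pose lift (q : {ffun 'I_n -> 'I_N}) i := s`_(q i).
pose can (x : 'I_n -> R) : {ffun 'I_n -> 'I_N} := [ffun i => ix (x i)].
have canP x i : I (x i - lift (can x) i) by rewrite /lift ffunE.
have can_eq x y : can x = can y <-> forall i, I (x i - y i).
  split=> [/ffunP xy i|xy]; first by apply/ix_eq; have := xy i; rewrite !ffunE.
  by apply/ffunP => i; rewrite !ffunE; apply/ix_eq.
pose D := [set q | can (lift q) == q]%SET.
have canD x : can x \in D.
  by rewrite inE; apply/eqP/can_eq => i; apply: Isym.
pose G q := can (F (lift q)).
have GD : (G @: D)%SET = D.
  apply/setP => q; apply/imsetP/idP => [[q' _ ->]|qD]; first exact: canD.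
  have [a Fa] := Fsurj (lift q); exists (can a) => //.
  move: qD; rewrite inE => /eqP <-; apply/can_eq => i.
  apply: (Itr (F a i)); first exact: Isym.
  exact: Fmod.
have Ginj : {in D &, injective G} by apply/imset_injP; rewrite GD.
move=> x y Fxy; apply/can_eq/Ginj; rewrite ?canD //; apply/can_eq => i.
apply: (Itr (F x i)); first by apply: Fmod => j; apply: Isym.
by apply: (Itr (F y i)) => //; apply: Fmod.
Qed.

Lemma quot_pow_proj (R : comNzRingType) (m : idealr R) k :
  exists pi : {rmorphism completion m -> quot_pow m k}, forall x, pi x = x k.
Proof.
pose g (x : completion m) : quot_pow m k := x k.
have gB : zmod_morphism g by move=> x y; reflexivity.
have gM : monoid_morphism g by split=> [|x y]; [exact: (rmorph1 (proj_pow m k)) | reflexivity].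
pose g' : {rmorphism completion m -> quot_pow m k} :=
  HB.pack g (GRing.isZmodMorphism.Build (completion m) (quot_pow m k) g gB)
            (GRing.isMonoidMorphism.Build (completion m) (quot_pow m k) g gM).
by exists g'.
Qed.

Notation polymap f a := (poly_map (idfun : {rmorphism _ -> _}) f a).

Lemma pmap_mod (R : comNzRingType) n (f : 'I_n -> {mpoly R[n]}) (I : R -> Prop)
    (x y : 'I_n -> R) :
  is_ideal I -> (forall i, I (x i - y i)) ->
  forall i, I (polymap f x i - polymap f y i).
Proof. by move=> Iid Ixy i; apply: mmap_mod. Qed.

Lemma completion_approx (R : comNzRingType) n (f : 'I_n -> {mpoly R[n]})
    (m : idealr R) :
  surjective (poly_map (comp_of m : {rmorphism R -> completion m}) f) ->
  forall k (b : 'I_n -> R), exists a : 'I_n -> R,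
    forall i, polymap f a i - b i \in ideal_pow m k.
Proof.
move=> fS [|k] b; first by exists (fun=> 0).
have [ah fah] := fS (fun i => comp_of m (b i)).
have [pi piE] := quot_pow_proj m k.
pose a i := sval (proj_pow_surj (ah i k)).
have aE i : proj_pow m k (a i) = ah i k by exact: (svalP (proj_pow_surj (ah i k))).
exists a => i; rewrite -proj_pow_eq; apply/eqP.
have fahi : pi (poly_map (comp_of m) f ah i) = proj_pow m k (b i).
  by rewrite fah piE.
rewrite -fahi /poly_map.
rewrite (@rmorph_mmap _ _ _ _ _ pi (proj_pow m k) ah (fun j => ah j k)) //.
by rewrite (@rmorph_mmap _ _ _ _ _ (proj_pow m k) (proj_pow m k) a (fun j => ah j k)).
Qed.

(** * Separation of points: f(X) - f(Y) generates a multiple of X - Y *)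

Lemma lift_Fp (R : comNzRingType) p (psi : {rmorphism R -> 'F_p}) v :
  exists r, psi r = v.
Proof. by exists (v : nat)%:R; rewrite rmorph_nat natr_Zp. Qed.

Lemma ker_maximal (R : comNzRingType) p (psi : {rmorphism R -> 'F_p}) :
  exists2 m : idealr R, maximal_ideal m & forall x, (x \in m) <-> psi x = 0.
Proof.
have [|m mP] := idealr_ex (ker_ideal psi).
  by rewrite rmorph1 => /eqP; rewrite oner_eq0.
exists m => // J mJ x xJ; apply/mP/eqP; apply: contraT => xnz.
have [r rE] := lift_Fp psi (psi x)^-1.
have : 1 - r * x \in J.
  by apply/mJ/mP; rewrite rmorphB rmorphM rE rmorph1 mulVf // subrr.
by move/rpredD => /(_ _ (idealMr r xJ)); rewrite subrK idealr1.
Qed.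

Lemma ideal_pow1 (R : comNzRingType) (m : idealr R) x :
  (x \in ideal_pow m 1) = (x \in m).
Proof.
apply/idP/idP => [/ideal_powS_sub //|xm].
by rewrite -[x]mulr1; apply: ideal_powM.
Qed.

Section Separation.
Variables (R : idomainType) (n : nat) (f : 'I_n -> {mpoly R[n]}).
Hypotheses (Rfg : fg R) (R0 : forall k, k.+1%:R != 0 :> R).
Hypothesis Rfin : finite_quotients R.
Hypothesis f_loc : forall m : idealr R, maximal_ideal m ->
  surjective (poly_map (comp_of m : {rmorphism R -> completion m}) f).

Lemma injective_mod_pow (m : idealr R) k (x y : 'I_n -> R) : maximal_ideal m ->
  (forall i, polymap f x i - polymap f y i \in ideal_pow m k) ->
  forall i, x i - y i \in ideal_pow m k.
Proof.
move=> mmax; have [s sP] := finite_ideal_pow (noetherian_fg Rfg)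
  (finite_reps (Rfin mmax)) k.
apply: (surjective_mod_injective (ideal_pow_ideal m k) sP).
  by move=> a b ab i; apply: (pmap_mod f (ideal_pow_ideal m k)).
exact: (completion_approx (f_loc mmax)).
Qed.

(** If m were contained in its square it would be contained in all its powers,
    and Krull's theorem would make a nonzero integer of m a multiple of itself by
    an element of m. *)
Lemma maximal_square (m : idealr R) p : p.+1%:R \in m ->
  ~ (forall x, x \in m -> x \in ideal_pow m 2).
Proof.
move=> pm m2; have m_pow k x : x \in m -> x \in ideal_pow m k.
  elim: k x => [|k IHk] x xm //.
  have /ideal_powSP[s /allP s2 ->] := m2 x xm.
  apply/ideal_powSP; exists s => //; apply/allP => u /s2 /andP[um].
  by rewrite ideal_pow1 => /IHk u2; rewrite /= um u2.
have [k|c cm /eqP] := krull_intersection (u := p.+1%:R) (noetherian_fg Rfg)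
    (ker_ideal (idfun : {rmorphism R -> R})) (m := m).
  by exists p.+1%:R; rewrite ?subrr //; apply: m_pow.
rewrite /= mulf_eq0 (negPf (R0 p)) orbF subr_eq0 => /eqP c1.
by move: cm; rewrite -c1 idealr1.
Qed.

(* The ring of two generic points X and Y is R[Y][X]. *)
Let P := {mpoly R[n]}.
Let B := {mpoly P[n]}.
Let C2 : {rmorphism R -> B} := (@mpolyC n P) \o (@mpolyC n R).
Let X (i : 'I_n) : B := 'X_i.
Let Y (i : 'I_n) : B := ('X_i : P)%:MP.
Let at2 (x y : 'I_n -> R) : {rmorphism B -> R} :=
  mmap (mmap (idfun : {rmorphism R -> R}) y : {rmorphism P -> R}) x.

Let at2C x y c : at2 x y (C2 c) = c.
Proof. by rewrite /at2 /C2 /= mmapC /= mmapC. Qed.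

Let at2X x y i : at2 x y (X i) = x i.
Proof. exact: mmap_var. Qed.

Let at2Y x y i : at2 x y (Y i) = y i.
Proof. by rewrite /at2 /Y /= mmapC /= mmapX mmap1U. Qed.

Let at2_psi (C : comNzRingType) (psi : {rmorphism B -> C}) x y :
  (forall i, psi (C2 (x i)) = psi (X i)) -> (forall i, psi (C2 (y i)) = psi (Y i)) ->
  forall b, psi (C2 (at2 x y b)) = psi b.
Proof.
move=> xE yE.
pose chi : {rmorphism B -> C} := psi \o (C2 \o at2 x y).
apply: (@mpoly_hom_ext P C n chi psi) => [c|i]; last first.
  by rewrite -xE -[in RHS](at2X x y).
pose chi1 : {rmorphism P -> C} := chi \o @mpolyC n P.
pose chi2 : {rmorphism P -> C} := psi \o @mpolyC n P.
apply: (@mpoly_hom_ext R C n chi1 chi2) => [d|i] /=.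
  by rewrite -[X in psi (C2 X) = _]/(at2 x y (C2 d)) at2C.
by rewrite -[RHS]yE -[in RHS](at2Y x y).
Qed.

(** Over a residue field F_p, two points with the same image coincide by
    injectivity modulo m, so a common zero of f(X) - f(Y) and det M would be a
    point where the linear part of f is singular.  Moving along a kernel vector w
    scaled by t in m does not change f modulo m^2, so injectivity modulo m^2 puts
    t w, and hence t, in m^2. *)
Lemma no_critical_point (M : 'M[B]_n) p (psi : {rmorphism B -> 'F_p}) :
  prime p ->
  (forall i, mmap C2 X (f i) - mmap C2 Y (f i) = \sum_j M i j * (X j - Y j)) ->
  (forall i, psi (mmap C2 X (f i)) = psi (mmap C2 Y (f i))) ->
  psi (\det M) = 0 -> False.
Proof.
move=> p_pr ME fXY detM.
pose psi0 : {rmorphism R -> 'F_p} := psi \o C2.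
have [m mmax mP] := ker_maximal psi0.
have psi_eval x h (Z : 'I_n -> B) : (forall i, psi0 (x i) = psi (Z i)) ->
    psi0 (mmap idfun x h) = psi (mmap C2 Z h).
  move=> xZ; rewrite (@rmorph_mmap _ _ _ _ _ psi0 psi0 x (fun i => psi (Z i))) //.
  by rewrite (@rmorph_mmap _ _ _ _ _ psi psi0 Z (fun i => psi (Z i))).
pose lift v := projT1 (cid (lift_Fp psi0 v)).
have liftE v : psi0 (lift v) = v by rewrite /lift; case: cid.
pose x i := lift (psi (X i)); pose y i := lift (psi (Y i)).
have XY i : psi (X i) = psi (Y i).
  have : x i - y i \in m.
    rewrite -ideal_pow1; apply: injective_mod_pow => // j.
    have xE := psi_eval x (f j) X (fun k => liftE _).
    have yE := psi_eval y (f j) Y (fun k => liftE _).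
    rewrite ideal_pow1; apply/mP; rewrite rmorphB; apply/eqP.
    by rewrite subr_eq0; apply/eqP; exact: (etrans xE (etrans (fXY j) (esym yE))).
  by move/mP/eqP; rewrite rmorphB subr_eq0 !liftE => /eqP.
have /eqP/det0P[v vnz vM] : \det (map_mx psi M)^T = 0.
  by rewrite det_tr det_map_mx.
have [j0 vj0] : exists j, v 0 j != 0.
  apply: contrapT => /forallNP v0; case/eqP: vnz; apply/rowP => j.
  by rewrite mxE; apply/eqP/negPn/negP/v0.
have p0 : (0 < p)%N by apply: prime_gt0.
apply: (@maximal_square m p.-1).
  by apply/mP; rewrite prednK // rmorph_nat pchar_Fp_0.
move=> t tm; pose w j := lift (v 0 j); pose x' j := x j + t * w j.
have psi0t : psi0 t = 0 by apply/mP.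
have MxE i j : psi0 (at2 x' x (M i j)) = psi (M i j).
  apply: at2_psi => k; rewrite -[LHS]/(psi0 _).
    by rewrite rmorphD rmorphM psi0t mul0r addr0 liftE.
  by rewrite liftE XY.
have at2_eval a b h : at2 a b (mmap C2 X h) = mmap idfun a h.
  by apply: rmorph_mmap => [c|i]; [exact: at2C | exact: at2X].
have at2_evalY a b h : at2 a b (mmap C2 Y h) = mmap idfun b h.
  by apply: rmorph_mmap => [c|i]; [exact: at2C | exact: at2Y].
have tw j : t * w j \in ideal_pow m 2.
  have <- : x' j - x j = t * w j by rewrite addrAC subrr add0r.
  apply: injective_mod_pow => // i.
  have -> : polymap f x' i - polymap f x i = t * \sum_j at2 x' x (M i j) * w j.
    rewrite /poly_map -(at2_eval x' x) -(at2_evalY x' x) -rmorphB ME rmorph_sum.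
    rewrite mulr_sumr; apply: eq_bigr => k _.
    by rewrite rmorphM rmorphB at2X at2Y addrAC subrr add0r mulrCA.
  apply: ideal_powM => //; rewrite ideal_pow1; apply/mP.
  have := congr1 (fun A : 'rV_n => A 0 i) vM; rewrite !mxE => vMi.
  rewrite -[RHS]vMi rmorph_sum; apply: eq_bigr => k _.
  by rewrite rmorphM MxE liftE !mxE mulrC.
have wm : 1 - w j0 * lift (v 0 j0)^-1 \in m.
  by apply/mP; rewrite rmorphB rmorphM rmorph1 !liftE mulfV ?subrr.
have -> : t = t * (1 - w j0 * lift (v 0 j0)^-1) + lift (v 0 j0)^-1 * (t * w j0).
  ring.
have [_ ID IM] := ideal_pow_ideal m 2.
apply: ID; last exact: (IM).
by apply: ideal_powM => //; rewrite ideal_pow1.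
Qed.

(** A positive integer lies in the ideal generated by the f_j(X) - f_j(Y) and
    det M, for want of a point over a prime field; Cramer's rule trades the
    multiple of det M for a combination of the f_j(X) - f_j(Y). *)
Lemma separation : exists (N : nat) (c : 'I_n -> 'I_n -> B), forall i,
  N.+1%:R * (X i - Y i) =
  \sum_j c i j * (mmap C2 X (f j) - mmap C2 Y (f j)).
Proof.
pose M : 'M[B]_n := \matrix_(i, j) projT1 (cid (mmap_diff C2 X Y (f i))) j.
have ME i : mmap C2 X (f i) - mmap C2 Y (f i) = \sum_j M i j * (X j - Y j).
  under eq_bigr => j _ do rewrite mxE.
  by case: cid.
pose g j := mmap C2 X (f j) - mmap C2 Y (f j).
pose I b := exists d w, (exists e : 'I_n -> B, w = \sum_j e j * g j) /\
                        b = w + idfun d * \det M.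
have Iid : is_ideal I by apply/submod_adjoin/comb_ideal.
have [[N [d [_ [[e ->] NE]]]]|noN] := pselect (exists N, I N.+1%:R).
  exists N, (fun i j => d * (\adj M) i j + e j * (X i - Y i)) => i.
  have detE : \det M * (X i - Y i) = \sum_j (\adj M) i j * g j.
    transitivity (((\adj M *m M) *m (\col_j (X j - Y j))) i 0).
      by rewrite mul_adj_mx mul_scalar_mx !mxE.
    rewrite -mulmxA mxE; apply: eq_bigr => j _; rewrite /g ME; congr (_ * _).
    by rewrite mxE; apply: eq_bigr => k _; rewrite !mxE.
  rewrite NE mulrDl -mulrA detE mulr_sumr mulr_suml -big_split.
  by apply: eq_bigr => j _ /=; rewrite -/(g j); ring.
have Bfg : fg B by apply: fg_mpoly; apply: fg_mpoly.
have [|p p_pr [psi psiI]] := Fp_point Bfg Iid.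
  by move=> k Ik; apply: noN; exists k.
case: (no_critical_point p_pr ME (psi := psi)) => [i|].
  apply/eqP; rewrite -subr_eq0 -rmorphB; apply/eqP/psiI.
  exists 0, (g i); split; first exact: comb_ideal_gen.
  by rewrite mul0r addr0.
apply: psiI; exists 1, 0; rewrite mul1r add0r; split=> //.
by have [] := comb_ideal g.
Qed.

End Separation.

(** * Solving f = b over R *)

Lemma fg_poly (R : comNzRingType) : fg R -> fg {poly R}.
Proof.
move=> [L Lgen]; exists ('X :: [seq c%:P | c <- L]) => W Ws WL p.
have WC c : W c%:P.
  apply: (Lgen (fun c => W c%:P)) => [|x xL].
    exact: (@subring_preim _ _ (@polyC R : {rmorphism R -> {poly R}})).
  by apply: WL; rewrite inE; apply/orP; right; apply: map_f.
rewrite -[p]coefK poly_def; apply: subring_sum => // i.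
have [_ _ WM] := Ws; rewrite -mul_polyC; apply: (WM) => //; apply: subringX => //.
by apply: WL; rewrite inE eqxx.
Qed.

Lemma exists_maximal (R : comNzRingType) (I : R -> Prop) :
  is_ideal I -> ~ I 1 ->
  exists2 m : idealr R, maximal_ideal m & forall x, I x -> x \in m.
Proof.
move=> Iid I1; have [x Ix x1|W [Wid IW W1 Wmax]] :=
    @maximal_submod _ _ _ I (fun x => x = 1) Iid.
  by apply: I1; rewrite -x1.
have [m mP] := idealr_ex Wid (fun W1' => W1 1 W1' erefl).
exists m => [J mJ x xJ|x /IW/mP //].
apply/mP; apply: contrapT => /Wmax[a [w [/mP/mJ wJ w1]]].
have : w + a * x \in J by rewrite rpredD // idealMr.
by rewrite [w + _]w1 idealr1.
Qed.

Section Solution.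
Variables (R : idomainType) (n : nat) (f : 'I_n -> {mpoly R[n]}).
Hypotheses (Rfg : fg R) (R0 : forall k, k.+1%:R != 0 :> R).
Hypothesis Rfin : finite_quotients R.
Hypothesis f_loc : forall m : idealr R, maximal_ideal m ->
  surjective (poly_map (comp_of m : {rmorphism R -> completion m}) f).
Variable b : 'I_n -> R.

Let P := {mpoly R[n]}.
Let g (j : 'I_n) : P := f j - (b j)%:MP.
Let fiber_ideal (h : P) := exists e : 'I_n -> P, h = \sum_j e j * g j.

Let fiber_idealP : is_ideal fiber_ideal. Proof. exact: comb_ideal. Qed.

Let fiber_eval (I : R -> Prop) (a : 'I_n -> R) h : is_ideal I ->
  (forall j, I (polymap f a j - b j)) -> fiber_ideal h -> I (mmap idfun a h).
Proof.
move=> Iid Ia [e ->]; rewrite rmorph_sum; apply: (submod_sum _ Iid) => j _.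
rewrite rmorphM; case: Iid => _ _; apply.
by rewrite rmorphB /= mmapC; apply: Ia.
Qed.

(** A nonzero s survives in some prime field, since s can be inverted in a
    finitely generated extension of R; over that field f = b has a solution,
    where everything in the ideal of the fiber vanishes. *)
Lemma fiber_meets_constants s : fiber_ideal s%:MP -> s = 0.
Proof.
move=> fs; apply/eqP; apply: contraT => snz.
have snzX : size (s *: 'X - 1 : {poly R}) = 2.
  by rewrite size_polyDl ?size_polyN ?size_poly1 size_scale ?size_polyX.
pose I (h : {poly R}) := exists a w, w = 0 /\ h = w + idfun a * (s *: 'X - 1).
have Iid : is_ideal I.
  by apply: submod_adjoin; exact: (ker_ideal (idfun : {rmorphism {poly R} -> _})).
have [|p p_pr [psi psiI]] := Fp_point (fg_poly Rfg) Iid.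
  move=> k [h [_ [->]]]; rewrite add0r /= => E.
  have hnz : h != 0.
    apply: contraNneq (R0 k) => h0; move: E; rewrite h0 mul0r -polyC_natr.
    by move/eqP; rewrite polyC_eq0.
  have := congr1 (fun q : {poly R} => size q) E.
  rewrite size_mul // -?size_poly_gt0 snzX // addn2 /= -polyC_natr.
  have := size_polyC_leq1 (k.+1%:R : R) => + sE; rewrite sE ltnS leqn0.
  by rewrite size_poly_eq0 (negPf hnz).
pose psi0 : {rmorphism R -> 'F_p} := psi \o polyC.
have [m mmax mP] := ker_maximal psi0.
have [a aP] := completion_approx (f_loc mmax) 1 b.
have sm : s \in m.
  have <- : mmap (idfun : {rmorphism R -> R}) a s%:MP = s by exact: mmapC.
  by apply: (fiber_eval (idealr_is_ideal m)) fs => j; rewrite -ideal_pow1.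
have : psi (s *: 'X - 1) = 0.
  by apply: psiI; exists 1, 0; rewrite /= mul1r add0r.
rewrite -mul_polyC rmorphB rmorphM rmorph1 -[psi s%:P]/(psi0 s).
by move/mP: sm => ->; rewrite mul0r sub0r => /eqP; rewrite oppr_eq0 oner_eq0.
Qed.

Let B := {mpoly P[n]}.

(** What the elimination needs to know about the inclusions of R and R[X] in
    R[Y][X]: coefficients with respect to X are polynomials in Y, to which a
    linear form on R[Y] can be applied. *)
Lemma two_points :
  exists (inR : {rmorphism R -> B}) (inX : {rmorphism P -> B}),
  [/\ forall r, inR r = (r%:MP)%:MP, forall r, inX r%:MP = inR r,
      forall nu, inX 'X_[nu] = 'X_[nu],
      forall h nu, (inX h)@_nu = (h@_nu)%:MP
    & exists (N : nat) (c : 'I_n -> 'I_n -> B), forall i,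
        N.+1%:R * ('X_i - ('X_i : P)%:MP) =
        \sum_j c i j * (inX (f j) - (f j)%:MP)].
Proof.
pose inR : {rmorphism R -> B} := (@mpolyC n P) \o (@mpolyC n R).
exists inR, (mmap inR (fun i => 'X_i)); split=> //.
- by move=> r; apply: mmapC.
- by move=> nu; rewrite /= mmapX mmap1_id.
- move=> h nu; exact: (mcoeff_map_mpoly (@mpolyC n R : {rmorphism R -> P}) nu h).
have [N [c cE]] := separation Rfg R0 Rfin f_loc.
exists N, c => i; rewrite [LHS]cE; apply: eq_bigr => j _; congr (_ * (_ - _)).
apply: (@mpoly_hom_ext R B n (mmap inR (fun i => ('X_i : P)%:MP)) (@mpolyC n P)).
  by move=> r; apply: mmapC.
by move=> k; apply: mmap_var.
Qed.

(** Elimination of the variables up to denominators.  If lambda is an R-linear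
    retraction of R[Y], localized at the nonzero constants, onto the fractions
    of R, killing the ideal of f(Y) - b, then applying lambda to the Y-part of
    N (X_i - Y_i) = sum_j c_ij (f_j(X) - f_j(Y)) writes a multiple of
    X_i - lambda(Y_i) as a combination of the f_j(X) - b_j.  The retraction is
    represented by its kernel W, a maximal R-submodule meeting R in 0. *)
Lemma elimination i : exists v u, v != 0 /\ fiber_ideal (v%:MP * 'X_i - u%:MP).
Proof.
have [C2 [inX [C2E inXC inXm inX_coef [N [c cE]]]]] := two_points.
have [fib0 fibD fibM] := fiber_idealP.
pose T (x : P) := exists2 s, s != 0 & x = s%:MP.
have fibm : is_submod (@mpolyC n R : {rmorphism R -> P}) fiber_ideal.
  by split=> // a x; apply: fibM.
have [x fx [s snz xE]|W [Wm fW WT Wmax]] := maximal_submod (T := T) fibm.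
  by case/eqP: snz; apply: fiber_meets_constants; rewrite -xE.
have [W0 WD WM] := Wm.
have denom h : exists rho s, rho != 0 /\ W (rho%:MP * h - s%:MP).
  have [Wh|/Wmax[a [w [Ww [s snz wE]]]]] := pselect (W h).
    by exists 1, 0; split; [exact: oner_neq0 | rewrite mpolyC1 mpolyC0 mul1r subr0].
  exists a, s; split; last first.
    by rewrite -wE opprD addrCA subrr addr0; apply: submodN Wm Ww.
  apply: contraPneq (WT w Ww) => a0; apply; exists s => //.
  by rewrite -wE a0 /= mul0r addr0.
pose calW (G : B) := forall nu, W G@_nu.
have calW0 : calW 0 by move=> nu; rewrite mcoeff0.
have calWD G H : calW G -> calW H -> calW (G + H).
  by move=> WG WH nu; rewrite mcoeffD; apply: WD.
have calWN G : calW G -> calW (- G).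
  by move=> WG nu; rewrite mcoeffN; exact: submodN Wm (WG nu).
have calWX h nu : W h -> calW (h%:MP * 'X_[nu]).
  move=> Wh mu; rewrite mcoeffCM mcoeffX.
  by case: eqP => _; rewrite ?mulr1 ?mulr0.
have calW_sum (I : Type) (r : seq I) (F : I -> B) :
    (forall i, calW (F i)) -> calW (\sum_(i <- r) F i).
  by move=> WF; elim/big_rec: _ => // j x _; apply: calWD.
have calWM h G : calW G -> calW (inX h * G).
  move: h G; apply: mpoly_gen => [|a G WG|j G WG]; first split.
  - by move=> G WG; rewrite rmorph1 mul1r.
  - move=> h1 h2 W1 W2 G WG; rewrite rmorphB mulrBl.
    by apply: (calWD); [exact: W1 | apply/calWN/W2].
  - by move=> h1 h2 W1 W2 G WG; rewrite rmorphM -mulrA; apply/W1/W2.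
  - by move=> nu; rewrite inXC C2E mcoeffCM; apply: WM.
  rewrite inXm (mpolyE G) mulr_sumr; apply: calW_sum => nu.
  rewrite -mul_mpolyC mulrCA -mpolyXD; exact: calWX.
have calW_inX h : calW (inX h) -> h = 0.
  move=> Wh; apply/mpolyP => nu; rewrite mcoeff0; apply: contrapT => /eqP hnz.
  by apply: (WT _ (Wh nu)); exists h@_nu.
have calW_fib h G : fiber_ideal h -> calW (h%:MP * G).
  by move=> fh nu; rewrite mcoeffCM mulrC; apply/fW/fibM.
(* A value in R[X] up to denominators, restricted by Q: the c_ij may take any
   value, while for S below it has to lie in the ideal of the fiber. *)
pose has_denom (Q : P -> Prop) (G : B) :=
  exists rho q, rho != 0 /\ (Q q /\ calW (C2 rho * G - inX q)).
have has_denom_sum Q (I : Type) (r : seq I) (F : I -> B) : is_ideal Q ->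
    (forall i, has_denom Q (F i)) -> has_denom Q (\sum_(i <- r) F i).
  move=> [Q0 QD QM] QF; elim/big_rec: _ => [|k G _ [rho [q [rnz [Qq Wq]]]]].
    exists 1, 0; split; first exact: oner_neq0.
    by split=> //; rewrite mulr0 rmorph0 subr0.
  have [sigma [s [snz [Qs Ws]]]] := QF k.
  exists (sigma * rho), (rho%:MP * s + sigma%:MP * q).
  split; first exact: mulf_neq0.
  split; first by apply: QD; apply: QM.
  have -> : C2 (sigma * rho) * (F k + G) - inX (rho%:MP * s + sigma%:MP * q) =
      inX rho%:MP * (C2 sigma * F k - inX s) +
      inX sigma%:MP * (C2 rho * G - inX q).
    by rewrite rmorphD !(rmorphM inX) !inXC (rmorphM C2); ring.
  by apply: (calWD); apply: (calWM).
have denomB G : has_denom (fun=> True) G.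
  rewrite (mpolyE G); apply: has_denom_sum => [//|nu].
  have [sigma [s [snz Ws]]] := denom G@_nu.
  exists sigma, (s%:MP * 'X_[nu]); split=> //; split=> //.
  have -> : C2 sigma * (G@_nu *: 'X_[nu]) - inX (s%:MP * 'X_[nu]) =
            (sigma%:MP * G@_nu - s%:MP)%:MP * 'X_[nu].
    rewrite (rmorphM inX) inXC inXm -mul_mpolyC mulrA -mulrBl; congr (_ * _).
    by rewrite !C2E mpolyCB mpolyCM.
  exact: calWX.
pose S := \sum_j c i j * inX (g j).
have [rho [q [rnz [fq Wq]]]] : has_denom fiber_ideal S.
  apply: has_denom_sum => // j.
  have [sigma [h [snz [_ Wh]]]] := denomB (c i j).
  exists sigma, (h * g j); split=> //; split.
    by apply: (fibM); apply: comb_ideal_gen.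
  have -> : C2 sigma * (c i j * inX (g j)) - inX (h * g j) =
            inX (g j) * (C2 sigma * c i j - inX h).
    by rewrite (rmorphM inX); ring.
  exact: calWM.
have [sigma [u [snz Wu]]] := denom 'X_i.
pose Yi : B := ('X_i : P)%:MP.
have WY : calW (C2 sigma * Yi - C2 u).
  have -> : C2 sigma * Yi - C2 u = (sigma%:MP * 'X_i - u%:MP)%:MP * 'X_[0].
    by rewrite mpolyX0 mulr1 !C2E mpolyCB mpolyCM.
  exact: calWX.
pose V := \sum_j c i j * (g j)%:MP.
have WV : calW V.
  apply: calW_sum => j; rewrite mulrC; apply: calW_fib.
  exact: comb_ideal_gen.
have SV : N.+1%:R * ('X_i - Yi) = S - V.
  rewrite cE /S /V -sumrB; apply: eq_bigr => j _; rewrite -mulrBr; congr (_ * _).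
  by rewrite /g rmorphB inXC mpolyCB C2E; ring.
exists (rho * sigma * N.+1%:R), (rho * u * N.+1%:R).
split; first by rewrite !mulf_neq0.
have -> : (rho * sigma * N.+1%:R)%:MP * 'X_i - (rho * u * N.+1%:R)%:MP =
          sigma%:MP * q; last exact: fibM.
apply/eqP; rewrite -subr_eq0; apply/eqP/calW_inX.
have -> : inX ((rho * sigma * N.+1%:R)%:MP * 'X_i - (rho * u * N.+1%:R)%:MP
               - sigma%:MP * q) =
    inX sigma%:MP * (C2 rho * S - inX q) - inX (rho * sigma)%:MP * V
    + inX (rho * N.+1%:R)%:MP * (C2 sigma * Yi - C2 u).
  rewrite !rmorphB !(rmorphM inX) !inXC inXm !(rmorphM C2) rmorph_nat.
  have -> : S = N.+1%:R * ('X_i - Yi) + V by rewrite SV subrK.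
  ring.
apply: (calWD); last exact: calWM.
by apply: (calWD); [exact: calWM | apply/calWN/calWM].
Qed.

(** The denominators found by elimination are spurious: at each maximal ideal m,
    substituting approximate solutions puts u in vR + m^k for all k, and Krull's
    theorem modulo v shows that no maximal ideal contains all denominators of
    u / v. *)
Lemma solution_mod_constants i :
  exists v a, v != 0 /\ fiber_ideal (v%:MP * ('X_i - a%:MP)).
Proof.
have [v [u [vnz fvu]]] := elimination i.
have vid : is_ideal (fun x => exists a, x = v * a).
  split=> [|_ _ [a ->] [a' ->]|c _ [a ->]]; first by exists 0; rewrite mulr0.
    by exists (a + a'); rewrite mulrDr.
  by exists (c * a); rewrite mulrCA.
suff [a ua] : exists a, u = v * a.
  by exists v, a; split=> //; rewrite mulrBr -rmorphM -ua.
pose D c := exists a, c * u = v * a.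
have Did : is_ideal D.
  have [D0 DD DM] := vid; split=> [|x y Dx Dy|c x Dx]; rewrite /D.
  - by rewrite mul0r.
  - by rewrite mulrDl; apply: DD.
  - by rewrite -mulrA; apply: DM.
apply: contrapT => nD.
have [|m mmax Dm] := exists_maximal Did.
  by move=> [a]; rewrite mul1r => ua; apply: nD; exists a.
have [k|c cm Qc] := krull_intersection (u := u) (noetherian_fg Rfg) vid (m := m).
  have [a aP] := completion_approx (f_loc mmax) k b.
  have := fiber_eval (ideal_pow_ideal m k) aP fvu.
  rewrite rmorphB rmorphM /= !mmapC mmap_var /= => vau.
  exists (u - v * a i); last by exists (a i); rewrite subKr.
  by rewrite -opprB; exact: submodN (ideal_pow_ideal m k) vau.
have : (1 - c) + c \in m by rewrite rpredD // Dm.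
by rewrite subrK idealr1.
Qed.

(** Modulo its ideal the fiber is the point a, up to a constant factor w; hence
    w (f(a) - b) is a constant in that ideal. *)
Lemma solution : exists a, polymap f a = b.
Proof.
have [fib0 fibD fibM] := fiber_idealP.
have /choice[v /choice[a va]] := solution_mod_constants.
exists a; apply: functional_extensionality_dep => j.
pose w := \prod_i v i.
have wnz : w != 0 by apply/prodf_neq0 => i _; case: (va i).
have [M ME] := mmap_diff (@mpolyC n R) (fun i => 'X_i) (fun i => (a i)%:MP) (f j).
have fX : mmap (@mpolyC n R) (fun i => 'X_i) (f j) = f j.
  apply: (@mpoly_hom_ext R P n (mmap (@mpolyC n R) (fun i => 'X_i)) idfun) => [c|i].
    exact: mmapC.
  exact: mmap_var.
have fa : mmap (@mpolyC n R) (fun i => (a i)%:MP) (f j) = (polymap f a j)%:MP.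
  by rewrite /poly_map (@rmorph_mmap _ _ _ _ _ (@mpolyC n R) (@mpolyC n R) a
                                     (fun i => (a i)%:MP)).
have fw : fiber_ideal (w%:MP * (f j - (polymap f a j)%:MP)).
  rewrite -[X in X - _]fX -fa ME mulr_sumr; apply: (submod_sum _ fiber_idealP) => i _.
  rewrite mulrCA; apply: (fibM).
  have -> : w = (\prod_(k | k != i) v k) * v i by rewrite /w (bigD1 i) //= mulrC.
  by rewrite mpolyCM -mulrA; apply: (fibM); case: (va i).
apply/eqP; rewrite -subr_eq0; apply/eqP/(mulfI wnz); rewrite mulr0.
apply: fiber_meets_constants.
have -> : (w * (polymap f a j - b j))%:MP =
          w%:MP * g j - w%:MP * (f j - (polymap f a j)%:MP) :> P.
  by rewrite mpolyCM mpolyCB /g; ring.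
apply: (submodB fiber_idealP) => //; apply: (fibM); exact: comb_ideal_gen.
Qed.

End Solution.

(** * Compactness of the completion *)

Definition infinitely_often (Q : nat -> Prop) : Prop :=
  forall N, exists2 j, (N <= j)%N & Q j.

Lemma pigeonhole (T : Type) (F : finType) (t : F -> T) (r : nat -> T)
    (E : T -> T -> Prop) (Q : nat -> Prop) :
  infinitely_often Q -> (forall j, exists q, E (r j) (t q)) ->
  exists q, infinitely_often (fun j => Q j /\ E (r j) (t q)).
Proof.
move=> Qinf rt; apply: contrapT => noq.
have bound q : exists N, forall j, (N <= j)%N -> Q j -> ~ E (r j) (t q).
  apply: contrapT => nob; apply: noq; exists q => N; apply: contrapT => noj.
  by apply: nob; exists N => j Nj Qj Ej; apply: noj; exists j.
have [N NP] := choice bound; have [j jN Qj] := Qinf (\max_q N q).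
have [q Eq] := rt j; apply: (NP q j _ Qj Eq).
exact: leq_trans (leq_bigmax q) jN.
Qed.

(** Konig's lemma: by the pigeonhole principle modulo I k.+1, infinitely many of
    the indices kept at stage k agree at stage k + 1. *)
Lemma adherent_tuple (R : comNzRingType) n (I : nat -> R -> Prop)
    (alpha : nat -> 'I_n -> R) :
  (forall k, is_ideal (I k)) -> (forall k x, I k.+1 x -> I k x) ->
  (forall k, exists s : seq R, forall x, exists2 t, t \in s & I k (x - t)) ->
  exists x : nat -> 'I_n -> R, (forall k i, I k (x k.+1 i - x k i)) /\
    forall k, infinitely_often (fun j => forall i, I k (alpha j i - x k i)).
Proof.
move=> Iid Idecr Ifin.
pose near k (y z : 'I_n -> R) := forall i, I k (y i - z i).
pose good k x := infinitely_often (fun j => near k (alpha j) x).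
have refine k Q : infinitely_often Q ->
    exists x, infinitely_often (fun j => Q j /\ near k (alpha j) x).
  move=> Qinf; have [s sP] := Ifin k.
  pose tup (q : {ffun 'I_n -> 'I_(size s)}) i := s`_(q i).
  have [j|q qP] := @pigeonhole _ _ tup alpha (near k) Q Qinf; last by exists (tup q).
  have tidx i : (index (projT1 (cid2 (sP (alpha j i)))) s < size s)%N.
    by rewrite index_mem; case: cid2.
  exists [ffun i => Ordinal (tidx i)] => i; rewrite /tup ffunE /=.
  by case: cid2 => t ts /= ?; rewrite nth_index.
have step1 k x : exists x', good k x -> near k x' x /\ good k.+1 x'.
  have [gx|ngx] := pselect (good k x); last by exists x.
  have [x' x'P] := refine k.+1 _ gx; exists x' => _; split.
    move=> i; have [j _ [jx jx']] := x'P 0%N.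
    rewrite -[x' i](subrK (alpha j i)) -addrA; have [_ ID _] := Iid k.
    apply: ID => //; rewrite -opprB; apply: submodN (Iid k) _; exact/Idecr/jx'.
  by move=> N; have [j Nj [_ jx']] := x'P N; exists j.
have step k : exists G : ('I_n -> R) -> ('I_n -> R),
    forall x, good k x -> near k (G x) x /\ good k.+1 (G x).
  by have [G GP] := choice (step1 k); exists G.
have [F FP] := choice step.
have [|x0 x0P] := refine 0%N (fun=> True); first by move=> N; exists N.
pose x := nat_rect (fun=> 'I_n -> R) x0 F.
have xgood k : good k (x k).
  elim: k => [|k IHk]; last by have [] := FP k (x k) IHk.
  by move=> N; have [j Nj [_ jx]] := x0P N; exists j.
exists x; split=> [k i|k]; last exact: xgood.
by have [+ _] := FP k (x k) (xgood k); apply.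
Qed.

Lemma completion_coherent (R : comNzRingType) (m : idealr R) (b : completion m)
    k j y :
  (k <= j)%N -> proj_pow m j y = b j -> proj_pow m k y = b k.
Proof.
move=> /subnKC <-; elim: (j - k)%N => [|d IHd]; first by rewrite addn0.
rewrite addnS => yb; apply: IHd.
by rewrite -transition_proj yb comp_compat.
Qed.

(** The approximate solutions provided by R accumulate at an exact solution in
    the completion. *)
Lemma completion_surjective (R : comNzRingType) n (f : 'I_n -> {mpoly R[n]})
    (m : idealr R) :
  (forall k, exists s : seq R, forall x,
     exists2 t, t \in s & x - t \in ideal_pow m k) ->
  surjective (fun a : 'I_n -> R => polymap f a) ->
  surjective (poly_map (comp_of m : {rmorphism R -> completion m}) f).
Proof.
move=> mfin fS b.
have bk_ex k : exists y : 'I_n -> R, forall i, proj_pow m k (y i) = b i k.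
  exists (fun i => sval (proj_pow_surj (b i k))) => i.
  exact: (svalP (proj_pow_surj (b i k))).
have [bk bkP] := choice bk_ex.
have [alpha alphaP] := choice (fun k => fS (bk k)).
have [||x [x_coh x_adh]] := @adherent_tuple R n
    (fun k y => y \in ideal_pow m k.+1) alpha (fun k => ideal_pow_ideal m k.+1).
- by move=> k y; apply: ideal_powS_decr.
- by move=> k; apply: mfin.
have xP i k : transition (proj_pow m k.+1 (x k.+1 i)) = proj_pow m k (x k i).
  by rewrite transition_proj; apply/eqP; rewrite proj_pow_eq.
pose a i : completion m := Completion (fun k => xP i k).
exists a; apply: functional_extensionality_dep => i; apply: completionP => k.
have [pi piE] := quot_pow_proj m k.
have [j kj jx] := x_adh k k.
have <- : proj_pow m k (polymap f (alpha j) i) = b i k.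
  by rewrite alphaP; apply: completion_coherent kj _; apply: bkP.
transitivity (proj_pow m k (polymap f (x k) i)).
  rewrite -piE /poly_map.
  rewrite (@rmorph_mmap _ _ _ _ _ pi (proj_pow m k) a (fun l => a l k)) //.
  by rewrite (@rmorph_mmap _ _ _ _ _ (proj_pow m k) (proj_pow m k) (x k)
                           (fun l => a l k)).
apply/eqP; rewrite proj_pow_eq.
apply: (pmap_mod f (ideal_pow_ideal m k.+1)) => l.
by rewrite -opprB; apply: submodN (ideal_pow_ideal m k.+1) _; apply: jx.
Qed.

(** * Affine domains with finite quotients *)

Lemma subring_nat (R : comNzRingType) (W : R -> Prop) k :
  is_subring W -> W k%:R.
Proof.
move=> Ws; have [W1 _ _] := Ws.
by elim: k => [|k IHk]; [exact: subring0 | rewrite -addn1 natrD; apply: subringD].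
Qed.

Lemma fg_of_fin_gen_ring (R : comNzRingType) : fin_gen_ring R -> fg R.
Proof.
move=> [k [a aP]]; exists [seq a i | i <- enum 'I_k] => W Ws Wa x.
have [p ->] := aP x; move: p.
apply: mpoly_gen => [|c|i].
- exact: (@subring_preim _ _ (mmap (intr : {rmorphism int -> R}) a)).
- rewrite mmapC /=; case: c => c; first exact: subring_nat.
  by rewrite NegzE mulrNz; apply: subringN => //; apply: subring_nat.
- by rewrite mmapX mmap1U; apply: Wa; apply: map_f; rewrite mem_enum.
Qed.

(** A subfield of characteristic zero would embed in every residue field, which
    cannot be finite then. *)
Lemma no_subfield (R : comNzRingType) (K : {pred R}) :
  (forall k, k.+1%:R != 0 :> R) -> finite_quotients R -> ~ subfield K.
Proof.
move=> R0 Rfin [[K1 KB KM] Kinv].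
have Ks : is_subring (fun x => x \in K) by split.
have [||m mmax _] := @exists_maximal R (fun x => x = 0).
- exact: (ker_ideal (idfun : {rmorphism R -> R})).
- by move/eqP; rewrite oner_eq0.
have nat_unit d : d.+1%:R \notin m.
  have [y _ dy] := Kinv _ (subring_nat d.+1 Ks) (R0 d).
  by apply/negP => /(idealMr y); rewrite mulrC dy idealr1.
have [s sP] := finite_reps (Rfin m mmax).
pose t i := projT1 (cid2 (sP i%:R)).
have tP i : t i \in s /\ i%:R - t i \in m by rewrite /t; case: cid2.
have tlt i : (index (t i) s < size s)%N by rewrite index_mem; case: (tP i).
pose F (i : 'I_(size s).+1) : 'I_(size s) := Ordinal (tlt i).
have Finj : injective F.
  suff ltF (i j : 'I_(size s).+1) : (i < j)%N -> F i <> F j.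
    move=> i j Fij; apply: val_inj.
    by case: (ltngtP i j) => // /ltF; rewrite Fij.
  move=> ij /(congr1 (nth 0 s \o val)) /=.
  have [[ti im] [tj jm]] := (tP i, tP j); rewrite !nth_index // => tij.
  have : j%:R - i%:R \in m.
    have -> : j%:R - i%:R = (j%:R - t j) - (i%:R - t i) by rewrite tij; ring.
    exact: rpredB.
  rewrite -natrB ?(ltnW ij) // => jim.
  by have := nat_unit (j - i).-1; rewrite prednK ?subn_gt0 // jim.
by have := leq_card F Finj; rewrite !card_ord ltnn.
Qed.

Lemma fg_of_affine (R : comNzRingType) :
  (forall k, k.+1%:R != 0 :> R) -> finite_quotients R -> affine R -> fg R.
Proof.
move=> R0 Rfin [|[K Ksub _]]; first exact: fg_of_fin_gen_ring.
by case: (no_subfield R0 Rfin Ksub).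
Qed.

Theorem theorem2p2 (R : idomainType) (n : nat) (f : 'I_n -> {mpoly R[n]}) :
  affine R -> [pchar R] =i pred0 -> finite_quotients R -> (0 < n)%N ->
  surjective (poly_map (idfun : {rmorphism R -> R}) f) <->
  forall m : idealr R, maximal_ideal m ->
    surjective (poly_map (comp_of m : {rmorphism R -> completion m}) f).
Proof.
move=> Raff R_pchar0 Rfin _.
have /pcharf0P R_nat0 := R_pchar0.
have R0 k : k.+1%:R != 0 :> R by rewrite R_nat0.
have Rfg : fg R by apply: fg_of_affine.
split=> [f_surj m mmax|f_loc b]; last exact: solution.
apply: completion_surjective f_surj.
exact: finite_ideal_pow (noetherian_fg Rfg) (finite_reps (Rfin m mmax)).
Qed.
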